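(* Let $N\ge 3$, let $\lambda_1,\dots,\lambda_N>0$ with $\sum_{i=1}^N\lambda_i=1$, let $S,Y\subseteq\mathbb R^n$ be compact, let $\rho\in\mathcal P_{\mathrm{ac}}(S)$, and let $\mu_2,\dots,\mu_N\in\mathcal P(Y)$ and $\tilde\mu_2,\dots,\tilde\mu_N\in\mathcal P(Y)$. Let $(T_2,\dots,T_N)$ and $(\tilde T_2,\dots,\tilde T_N)$ be the multi-marginal optimal transport maps associated with $(\rho,\mu_2,\dots,\mu_N)$ and $(\rho,\tilde\mu_2,\dots,\tilde\mu_N)$ respectively, and set $B=\lambda_1\mathrm{Id}+\sum_{i=2}^N\lambda_iT_i$, $\tilde B=\lambda_1\mathrm{Id}+\sum_{i=2}^N\lambda_i\tilde T_i$. Assume that $B=\tilde B$ ($\rho$-a.e.). Then there exists a constant $C>0$, depending only on $N$ and $\operatorname{diam}(S\cup Y)$, such that $$\sum_{i=2}^N\lambda_i\|T_i-\tilde T_i\|_{L^2(\rho)}\le C\Big(\sum_{i=2}^N\lambda_iW_1(\mu_i,\tilde\mu_i)\Big)^{1/2}.$$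
   Context: $\mathcal P(E)$ is the set of Borel probability measures on $E$; $\mathcal P_{\mathrm{ac}}(S)$ is the set of probability measures on $S$ absolutely continuous with respect to the Lebesgue measure $\mathcal L^n$. $W_1$ is the 1-Wasserstein distance for the Euclidean distance. The barycentric quadratic cost is $c(x_1,\dots,x_N)=\inf_{y\in\mathbb R^n}\sum_{i=1}^N\frac{\lambda_i}{2}|x_i-y|^2=\frac12\sum_{1\le i<j\le N}\lambda_i\lambda_j|x_i-x_j|^2$. Given $\rho\in\mathcal P_{\mathrm{ac}}(S)$ and $\mu_2,\dots,\mu_N\in\mathcal P(Y)$, the multi-marginal optimal transport maps associated with $(\rho,\mu_2,\dots,\mu_N)$ are the ($\rho$-a.e. unique, by a theorem of Gangbo and Święch) minimizers $(T_2,\dots,T_N)$ of $\int_S c(x_1,T_2(x_1),\dots,T_N(x_1))\,d\rho(x_1)$ among maps $T_i:S\to Y$ with $(T_i)_\#\rho=\mu_i$, $i=2,\dots,N$. *)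

(* Defs.v *)
From HB Require Import structures.
From mathcomp Require Import all_boot all_order all_algebra.
From mathcomp Require Import all_classical all_reals all_analysis.
From mathcomp Require Import measurable_realfun.

Set Implicit Arguments.
Unset Strict Implicit.
Unset Printing Implicit Defensive.

Import Order.TTheory GRing.Theory Num.Theory.
Import numFieldNormedType.Exports.

Local Open Scope classical_set_scope.
Local Open Scope ring_scope.

(* R^n is 'rV[R]_n with the library topology.  The library norm `|x| of a row
   vector is the sup norm; the Euclidean norm is enorm. *)

Definition enorm (R : realType) (n : nat) (x : 'rV[R]_n) : R :=
  Num.sqrt (\sum_(j < n) x 0 j ^+ 2).

Definition ediam (R : realType) (n : nat) (A : set 'rV[R]_n) : R :=
  sup [set enorm (x - y) | x in A & y in A].

(* The Borel sigma-algebra, generated by the open sets. *)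
HB.instance Definition _ (R : realType) (m n : nat) :=
  @isMeasurable.Build (sigma_display (@open 'M[R]_(m, n))) 'M[R]_(m, n)
    <<s (@open 'M[R]_(m, n)) >>
    (@sigma_algebra0 _ setT (@open 'M[R]_(m, n)))
    (@sigma_algebraC 'M[R]_(m, n) (@open 'M[R]_(m, n)))
    (@sigma_algebra_bigcup _ setT (@open 'M[R]_(m, n))).

Section Lebesgue.
Variable R : realType.

Lemma open_measurable_rV n (U : set 'rV[R]_n) : open U -> measurable U.
Proof. by move=> oU; exact: sub_sigma_algebra. Qed.

Lemma rat_ball_near n (x : 'rV[R]_n) (e : R) : 0 < e ->
  exists q : 'rV[rat]_n, ball (map_mx ratr q : 'rV[R]_n) e x.
Proof.
move=> e0.
have H (i : 'I_n) : exists r : rat, `|ratr r - x 0 i| < e.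
  have [|r] := @rat_in_itvoo R (x 0 i - e) (x 0 i + e).
    by rewrite ltrBlDr -addrA ltrDl addr_gt0.
  rewrite in_itv/= => /andP[h1 h2]; exists r.
  by rewrite ltr_norml ltrBrDl h1 /= ltrBlDl.
have [f Pf] := choice H.
exists (\row_i f i); split => // i j; rewrite !mxE (ord1 i).
exact: Pf.
Qed.

Lemma open_bigcup_rat_ball n (U : set 'rV[R]_n) : open U ->
  U = \bigcup_(p in [set p : 'rV[rat]_n * nat |
        ball (map_mx ratr p.1 : 'rV[R]_n) p.2.+1%:R^-1 `<=` U])
      ball (map_mx ratr p.1 : 'rV[R]_n) p.2.+1%:R^-1.
Proof.
move=> oU; apply/seteqP; split => [x Ux|x [p pU]]; last exact: pU.
have /nbhs_ballP[e /= e0 eU] : nbhs x U by exact: open_nbhs_nbhs.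
have e20 : 0 < e / 2 by rewrite divr_gt0.
have [k ke] : exists k, k.+1%:R^-1 < e / 2.
  have [k _ /(_ _ (leqnn _)) /= kP] := near_infty_natSinv_lt (PosNum e20).
  by exists k.
have k0 : 0 < k.+1%:R^-1 :> R by rewrite invr_gt0.
have [q qx] := rat_ball_near x k0.
exists (q, k) => //= y qy; apply: eU.
rewrite (splitr e); apply: (@ball_triangle _ _ (map_mx ratr q : 'rV[R]_n)).
  by apply: ball_sym; apply: le_ball qx; exact: ltW.
by apply: le_ball qy; exact: ltW.
Qed.

Definition cons_rV n (p : measurableTypeR R * 'rV[R]_n) : 'rV[R]_n.+1 :=
  \row_j oapp (p.2 0) p.1 (unlift ord0 j).

Lemma cons_rV0 n (p : measurableTypeR R * 'rV[R]_n) : cons_rV p 0 0 = p.1.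
Proof. by rewrite mxE unlift_none. Qed.

Lemma cons_rVS n (p : measurableTypeR R * 'rV[R]_n) i : cons_rV p 0 (lift ord0 i) = p.2 0 i.
Proof. by rewrite mxE liftK. Qed.

Lemma measurable_cons_rV n : measurable_fun setT (@cons_rV n).
Proof.
apply: (@measurability _ _ _ _ _ _ (@open 'rV[R]_n.+1)) => //.
move=> _ [U oU <-]; rewrite setTI (open_bigcup_rat_ball oU) preimage_bigcup.
rewrite bigcup_mkcond; apply: countable_bigcupT_measurable.
  exact: countableP.
move=> [q k]; case: ifPn => // _.
rewrite (_ : _ @^-1` _ = ball (ratr (q 0 0) : R) k.+1%:R^-1 `*`
    ball (map_mx ratr (\row_i q 0 (lift ord0 i)) : 'rV[R]_n) k.+1%:R^-1).
  apply: measurableX; first exact: measurable_ball.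
  by apply: open_measurable_rV; exact: ball_open.
apply/seteqP; split => [[x v] [/= k0 xv]|[x v] [/= qx [k0 qv]]].
- split => /=.
    by have := xv 0 0; rewrite cons_rV0 mxE.
  split => // i j; have := xv i (lift ord0 j).
  by rewrite (ord1 i) cons_rVS !mxE.
- split => // i j; rewrite (ord1 i).
  case: (unliftP ord0 j) => [j'|] ->.
    by have := qv 0 j'; rewrite cons_rVS !mxE.
  by rewrite cons_rV0 mxE.
Qed.

Definition uncons_rV n (x : 'rV[R]_n.+1) : measurableTypeR R * 'rV[R]_n :=
  (x 0 0, \row_j x 0 (lift ord0 j)).

Lemma cons_rVK n : cancel (@cons_rV n) (@uncons_rV n).
Proof.
move=> [x v]; congr pair; first by rewrite cons_rV0.
by apply/rowP => j; rewrite mxE cons_rVS.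
Qed.

Lemma measurable_coord n (j : 'I_n) :
  measurable_fun setT (fun x : 'rV[R]_n => x 0 j).
Proof.
apply: (@measurability _ _ _ _ _ _ (@RGenOpens.G R)).
  exact: RGenOpens.measurableE.
move=> _ [_ [a [b ->]] <-]; rewrite setTI; apply: open_measurable_rV.
apply: open_comp; last exact: interval_open.
by move=> x _; exact: coord_continuous.
Qed.

Lemma measurable_uncons_rV n : measurable_fun setT (@uncons_rV n).
Proof.
apply: measurable_fun_pair; first exact: measurable_coord.
apply: (@measurability _ _ _ _ _ _ (@open 'rV[R]_n)) => //.
move=> _ [U oU <-]; rewrite setTI; apply: open_measurable_rV.
apply: open_comp oU => x _ V [P PV PsubV].
exists (fun i k => oapp (P i) setT (unlift ord0 k)) => [i k|y yP].
  case: (unliftP ord0 k) => [j ->|_] /=; last exact: filterT.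
  by have := PV i j; rewrite mxE (ord1 i).
apply: PsubV => i j; rewrite mxE.
by have := yP i (lift ord0 j); rewrite liftK (ord1 i).
Qed.

Section lebesgue_cons.
Local Open Scope ereal_scope.
Variables (n : nat) (mu : {sigma_finite_measure set 'rV[R]_n -> \bar R}).

Definition lebesgue_cons : set 'rV[R]_n.+1 -> \bar R :=
  pushforward (@lebesgue_measure R \x mu) (@cons_rV n).

Let mcons (A : set 'rV[R]_n.+1) :
  measurable A -> measurable (@cons_rV n @^-1` A).
Proof. by move=> mA; rewrite -[X in measurable X]setTI; exact: measurable_cons_rV. Qed.

Let lebesgue_cons0 : lebesgue_cons set0 = 0.
Proof. by rewrite /lebesgue_cons /pushforward preimage_set0 measure0. Qed.

Let lebesgue_cons_ge0 A : 0 <= lebesgue_cons A.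
Proof. by rewrite /lebesgue_cons /pushforward; exact: measure_ge0. Qed.

Let lebesgue_cons_sigma_additive : semi_sigma_additive lebesgue_cons.
Proof.
move=> F mF tF mUF; rewrite /lebesgue_cons /pushforward preimage_bigcup.
apply: measure_semi_sigma_additive.
- by move=> k; exact: mcons.
- apply/trivIsetP => /= i j _ _ ij; rewrite -preimage_setI.
  by move/trivIsetP : tF => /(_ _ _ _ _ ij) ->//; rewrite preimage_set0.
- by rewrite -preimage_bigcup; exact: mcons.
Qed.

HB.instance Definition _ := isMeasure.Build _ _ _ lebesgue_cons
  lebesgue_cons0 lebesgue_cons_ge0 lebesgue_cons_sigma_additive.

Let lebesgue_cons_sigma_finite : sigma_finite setT lebesgue_cons.
Proof.
have /sigma_finiteP[F [TF ndF Foo]] := sigma_finiteT (@lebesgue_measure R).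
have /sigma_finiteP[G [TG ndG Goo]] := sigma_finiteT mu.
exists (fun k => @uncons_rV n @^-1` (F k `*` G k)).
  apply/seteqP; split => // x _.
  have : [set: measurableTypeR R] (uncons_rV x).1 by [].
  have : [set: 'rV[R]_n] (uncons_rV x).2 by [].
  rewrite TF TG => -[k _ Gk] [l _ Fl]; exists (maxn k l) => //; split.
  - by move: Fl; exact/subsetPset/ndF/leq_maxr.
  - by move: Gk; exact/subsetPset/ndG/leq_maxl.
move=> k; have [mF Fk] := Foo k; have [mG Gk] := Goo k.
have mFG : measurable (F k `*` G k) by exact: measurableX.
split; first by rewrite -[X in measurable X]setTI; exact: measurable_uncons_rV.
rewrite /lebesgue_cons /pushforward -comp_preimage.
rewrite (_ : _ \o _ = id); last by apply/funext => p; exact: cons_rVK.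
by rewrite preimage_id product_measure1E// lte_mul_pinfty// ge0_fin_numE.
Qed.

HB.instance Definition _ := Measure_isSigmaFinite.Build _ _ _ lebesgue_cons
  lebesgue_cons_sigma_finite.

End lebesgue_cons.

(* L^n, as the n-fold product of the one-dimensional Lebesgue measure. *)
Fixpoint lebesgue_rV (n : nat) :
    {sigma_finite_measure set 'rV[R]_n -> \bar R} :=
  match n with
  | 0 => [the {sigma_finite_measure set 'rV[R]_0 -> \bar R} of dirac (0 : 'rV[R]_0)]
  | n'.+1 => [the {sigma_finite_measure set 'rV[R]_n'.+1 -> \bar R} of
               lebesgue_cons (lebesgue_rV n')]
  end.

Lemma lebesgue_rV_box n (a b : 'rV[R]_n) : (forall j, a 0 j <= b 0 j) ->
  lebesgue_rV n [set x | forall j, a 0 j < x 0 j <= b 0 j] =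
  (\prod_(j < n) (b 0 j - a 0 j))%:E.
Proof.
elim: n a b => [a b _|n IH a b ab].
  by rewrite big_ord0 /= diracE mem_set// => -[].
pose a' : 'rV[R]_n := \row_j a 0 (lift ord0 j).
pose b' : 'rV[R]_n := \row_j b 0 (lift ord0 j).
pose B := [set x : 'rV[R]_n | forall j, a' 0 j < x 0 j <= b' 0 j].
have mB : measurable B.
  rewrite (_ : B = \bigcap_(j in [set: 'I_n])
      ((fun x : 'rV[R]_n => x 0 j) @^-1` `]a' 0 j, b' 0 j]%classic)).
    apply: fin_bigcap_measurable => // j _.
    by rewrite -[X in measurable X]setTI; exact: measurable_coord.
  apply/seteqP; split => x /= H j; last by have := H j I; rewrite /= in_itv.
  by move=> _; rewrite /= in_itv/=; exact: H.
rewrite big_ord_recl /= /lebesgue_cons /pushforward.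
rewrite (_ : _ @^-1` _ = (`]a 0 0, b 0 0]%classic : set (measurableTypeR R)) `*` B).
  rewrite product_measure1E// IH; last by move=> j; rewrite !mxE.
  rewrite EFinM; congr (_ * _)%E.
    have /= -> := lebesgue_measure_itv `]a 0 0, b 0 0].
    rewrite lte_fin -EFinD; case: ltP => // ba.
    by have /eqP -> : a 0 0 == b 0 0; rewrite ?subrr// eq_le ab.
  by congr EFin; apply: eq_bigr => j _; rewrite !mxE.
apply/seteqP; split => [p pB|p [p1 p2] j].
  split; first by have := pB 0; rewrite cons_rV0 /= in_itv.
  by move=> j; have := pB (lift ord0 j); rewrite cons_rVS !mxE.
case: (unliftP ord0 j) => [i|] ->; last by rewrite cons_rV0; move: p1; rewrite /= in_itv.
by have := p2 i; rewrite cons_rVS !mxE.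
Qed.

End Lebesgue.

Section MultiMarginal.
Variables (R : realType) (n : nat).
Local Notation E := 'rV[R]_n.

(* W_1, as the infimum over couplings gamma of mu and nu of the integral of
   the Euclidean distance. *)
Definition coupling (mu nu : probability E R)
    (gamma : probability (E * E)%type R) : Prop :=
  (forall A, measurable A -> gamma (fst @^-1` A) = mu A) /\
  (forall A, measurable A -> gamma (snd @^-1` A) = nu A).

Definition W1 (mu nu : probability E R) : \bar R :=
  ereal_inf [set (\int[gamma]_z (enorm (z.1 - z.2))%:E)%E |
    gamma in coupling mu nu].

Definition barycentric_cost (N : nat) (lambda : 'I_N -> R) (x : 'I_N -> E) : R :=
  inf [set \sum_(i < N) lambda i / 2 * enorm (x i - y) ^+ 2 | y in [set: E]].

(* With N = m.+1, the index ord0 : 'I_N is the first marginal and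
   lift ord0 i, for i : 'I_m, runs through the N - 1 others; families that
   only involve the latter (T_2, ..., T_N) are indexed by 'I_m. *)
Definition fcons (m : nat) (x1 : E) (x : 'I_m -> E) (i : 'I_m.+1) : E :=
  oapp x x1 (unlift ord0 i).

(* T is a Borel map S -> Y with T_# rho = mu, where rho is carried by S.
   Only the values of T on S are relevant. *)
Definition transport_map (S Y : set E) (rho mu : probability E R)
    (T : E -> E) : Prop :=
  [/\ measurable_fun S T,
      (forall x, S x -> Y (T x)) &
      (forall A, measurable A -> rho (S `&` T @^-1` A) = mu A)].

Definition mmot_cost (m : nat) (lambda : 'I_m.+1 -> R) (S : set E)
    (rho : probability E R) (T : 'I_m -> E -> E) : \bar R :=
  (\int[rho]_(x in S)
    (barycentric_cost lambda (fcons x (fun i => T i x)))%:E)%E.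

Definition mmot_maps (m : nat) (lambda : 'I_m.+1 -> R) (S Y : set E)
    (rho : probability E R) (mu : 'I_m -> probability E R)
    (T : 'I_m -> E -> E) : Prop :=
  (forall i, transport_map S Y rho (mu i) (T i)) /\
  (forall T' : 'I_m -> E -> E,
    (forall i, transport_map S Y rho (mu i) (T' i)) ->
    (mmot_cost lambda S rho T <= mmot_cost lambda S rho T')%E).

Definition barycenter_map (m : nat) (lambda : 'I_m.+1 -> R)
    (T : 'I_m -> E -> E) (x : E) : E :=
  lambda ord0 *: x + \sum_(i < m) lambda (lift ord0 i) *: T i x.

Definition L2_dist (S : set E) (rho : probability E R) (T T' : E -> E) :
    \bar R :=
  ('N[rho]_(2%:E)[(fun x => (enorm (T x - T' x))%:E) \_ S])%E.

End MultiMarginal.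

(* Main.v *)
Require Import Defs.
From mathcomp Require Import all_boot all_order all_algebra.
From mathcomp Require Import all_classical all_reals all_analysis.
From mathcomp Require Import measurable_realfun ring lra.
Set Implicit Arguments.
Unset Strict Implicit.
Unset Printing Implicit Defensive.

Import Order.TTheory GRing.Theory Num.Theory.
Import numFieldNormedType.Exports.
Local Open Scope classical_set_scope.
Local Open Scope ring_scope.

(** The proof compares the two optimal families directly, without dual
    potentials.

    Write the cost as half the weighted sum of the [|x_i - p|^2] minus half the
    squared norm of the barycenter relative to [p] ([barycentric_costE]). If
    one component [T_i] of an optimal family is replaced by another map [V]
    with the same law, the terms in [|x_i - p|^2] do not change the total, and
    optimality says that the mean of
    [2 l <B - p, V - T_i> + l^2 |V - T_i|^2], where [l] is the [i]-th weight,
    is nonpositive ([mmot_replace_le]). The quadratic term is what gives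
    stability.

    The component [T'_i] of the other family has the law [mu'_i] instead of
    [mu_i], hence is not an admissible replacement. But given a coupling of
    [mu_i] and [mu'_i], there are maps [V] with law [mu_i] whose mean distance
    to [T'_i] is at most the cost of the coupling plus an arbitrarily small
    error ([exists_transport_near]). All points are in a set of diameter [D],
    so that substituting [T'_i] for [V] costs at most [4 D l] times that
    distance ([mmot_coupling_le]). The same holds with the two families
    exchanged. As the barycenters agree, the linear terms are opposite, and the
    sum of both inequalities is
    [l^2 ||T_i - T'_i||^2 <= 4 D l W_1(mu_i, mu'_i)] ([mmot_maps_W1_le]).
    Square roots and summation over [i] finish the proof.

    The existence of [V] is the only place where the absolute continuity of
    [rho] enters: the first coordinate then has an atomless law. On the real
    line an atomless measure is carried onto any measure of the same mass by
    monotone rearrangement ([exists_rearrangement]), and bounded row vectors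
    are encoded by real numbers in a Borel way ([exists_borel_code]). *)

(** * Euclidean norm and barycentric cost *)

Section Euclidean.
Context {R : realType} {n : nat}.
Implicit Types (x y z : 'rV[R]_n) (a b : R).

Definition dot x y : R := \sum_(j < n) x 0 j * y 0 j.

Lemma dotC x y : dot x y = dot y x.
Proof. by apply: eq_bigr => j _; rewrite mulrC. Qed.

Lemma dotDl x y z : dot (x + y) z = dot x z + dot y z.
Proof. by rewrite -big_split; apply: eq_bigr => j _; rewrite mxE mulrDl. Qed.

Lemma dotZl a x y : dot (a *: x) y = a * dot x y.
Proof. by rewrite mulr_sumr; apply: eq_bigr => j _; rewrite mxE mulrA. Qed.

Lemma dotNl x y : dot (- x) y = - dot x y.
Proof. by rewrite -scaleN1r dotZl mulN1r. Qed.

Lemma dotDr x y z : dot x (y + z) = dot x y + dot x z.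
Proof. by rewrite dotC dotDl !(dotC x). Qed.

Lemma dotZr a x y : dot x (a *: y) = a * dot x y.
Proof. by rewrite dotC dotZl dotC. Qed.

Lemma dotNr x y : dot x (- y) = - dot x y.
Proof. by rewrite dotC dotNl dotC. Qed.

Lemma dot_suml I (r : seq I) (P : pred I) (F : I -> 'rV[R]_n) y :
  dot (\sum_(i <- r | P i) F i) y = \sum_(i <- r | P i) dot (F i) y.
Proof.
apply: (big_morph (dot^~ y)) => [u v|]; first exact: dotDl.
by rewrite /dot big1// => j _; rewrite mxE mul0r.
Qed.

Definition dotE := (dotDl, dotDr, dotNl, dotNr, dotZl, dotZr).

Lemma dotxx_ge0 x : 0 <= dot x x.
Proof. by apply: sumr_ge0 => j _; rewrite -expr2 sqr_ge0. Qed.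

Lemma enorm_sqr x : enorm x ^+ 2 = dot x x.
Proof.
rewrite /enorm sqr_sqrtr; last by apply: sumr_ge0 => j _; exact: sqr_ge0.
by apply: eq_bigr => j _; rewrite expr2.
Qed.

Lemma enorm_ge0 x : 0 <= enorm x. Proof. exact: sqrtr_ge0. Qed.

Lemma coord_le_enorm x j : `|x 0 j| <= enorm x.
Proof.
rewrite -sqrtr_sqr ler_wsqrtr// (bigD1 j)//= lerDl.
by apply: sumr_ge0 => k _; exact: sqr_ge0.
Qed.

Lemma enorm_eq0 x : enorm x = 0 -> x = 0.
Proof.
move=> x0; apply/rowP => j; apply/eqP; rewrite mxE -normr_le0 -x0.
exact: coord_le_enorm.
Qed.

(** Cauchy-Schwarz, by expanding the square of [|y| x - |x| y]. *)
Lemma dot_le_enorm x y : dot x y <= enorm x * enorm y.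
Proof.
have dot0 z : dot 0 z = 0 by rewrite -(scale0r 0) dotZl mul0r.
have [/enorm_eq0->|x0] := eqVneq (enorm x) 0.
  by rewrite dot0 mulr_ge0 ?enorm_ge0.
have [/enorm_eq0->|y0] := eqVneq (enorm y) 0.
  by rewrite dotC dot0 mulr_ge0 ?enorm_ge0.
have xy0 : 0 < enorm x * enorm y by rewrite mulr_gt0 ?lt0r ?x0 ?y0 ?enorm_ge0.
have := dotxx_ge0 (enorm y *: x - enorm x *: y).
rewrite !dotE (dotC y x) -!enorm_sqr => H.
rewrite -(ler_pM2l xy0); nra.
Qed.

Lemma ler_enormD x y : enorm (x + y) <= enorm x + enorm y.
Proof.
rewrite -(ler_pXn2r (n := 2))// ?nnegrE ?addr_ge0 ?enorm_ge0//.
rewrite sqrrD !enorm_sqr !dotE (dotC y x).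
have := dot_le_enorm x y; lra.
Qed.

Lemma enormN x : enorm (- x) = enorm x.
Proof. by rewrite /enorm; congr Num.sqrt; apply: eq_bigr => j _; rewrite mxE sqrrN. Qed.

Lemma enormB x y : enorm (x - y) = enorm (y - x).
Proof. by rewrite -enormN opprB. Qed.

Lemma enormZ a x : enorm (a *: x) = `|a| * enorm x.
Proof.
apply/eqP; rewrite -(eqrXn2 (n := 2))// ?mulr_ge0 ?enorm_ge0//.
by rewrite exprMn !enorm_sqr !dotE real_normK ?num_real// expr2 mulrA.
Qed.

Lemma enorm0 : enorm (0 : 'rV[R]_n) = 0.
Proof. by rewrite -(scale0r 0) enormZ normr0 mul0r. Qed.

Lemma ler_enorm_sum I (r : seq I) (P : pred I) (F : I -> 'rV[R]_n) :
  enorm (\sum_(i <- r | P i) F i) <= \sum_(i <- r | P i) enorm (F i).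
Proof.
elim/big_ind2 : _ => [|u a v b ua vb|//]; first by rewrite enorm0.
exact: le_trans (ler_enormD _ _) (lerD ua vb).
Qed.

Lemma enorm_le_coord (a : R) x : 0 <= a -> (forall j, `|x 0 j| <= a) -> enorm x <= n%:R * a.
Proof.
move=> a0 xa; rewrite -(ler_pXn2r (n := 2))// ?nnegrE ?mulr_ge0 ?enorm_ge0//.
rewrite enorm_sqr exprMn.
apply: (@le_trans _ _ (\sum_(j < n) a ^+ 2)).
  by apply: ler_sum => j _; rewrite -expr2 -real_normK ?num_real// lerXn2r ?nnegrE.
rewrite sumr_const card_ord -[leLHS]mulr_natl ler_wpM2r ?sqr_ge0//.
by rewrite -natrX ler_nat expnS expn1; case: (n) => // k; rewrite leq_pmulr.
Qed.

End Euclidean.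

Section BarycentricCost.
Context {R : realType} {n N : nat}.
Variables (lambda : 'I_N -> R).
Hypothesis lambda1 : \sum_(i < N) lambda i = 1.
Implicit Types (x : 'I_N -> 'rV[R]_n) (p : 'rV[R]_n).

Lemma sum_lambda_shift x p :
  \sum_(i < N) lambda i *: (x i - p) = \sum_(i < N) lambda i *: x i - p.
Proof.
under eq_bigr do rewrite scalerBr.
by rewrite sumrB -scaler_suml lambda1 scale1r.
Qed.

(** The infimum is attained at the barycenter, so completing the square
    around it gives a closed form. Any origin [p] may be used; one taken in
    the support of the first marginal keeps all terms bounded by the
    diameter. *)
Lemma barycentric_costE x p :
  barycentric_cost lambda x =
  2^-1 * \sum_(i < N) lambda i * enorm (x i - p) ^+ 2
  - 2^-1 * enorm (\sum_(i < N) lambda i *: x i - p) ^+ 2.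
Proof.
rewrite -sum_lambda_shift; set b := \sum_(i < N) lambda i *: (x i - p).
set Q := \sum_(i < N) lambda i * _.
have H y : \sum_(i < N) lambda i / 2 * enorm (x i - y) ^+ 2 =
    2^-1 * Q - 2^-1 * enorm b ^+ 2 + 2^-1 * enorm (b - (y - p)) ^+ 2.
  have -> : \sum_(i < N) lambda i / 2 * enorm (x i - y) ^+ 2 =
    2^-1 * Q - dot b (y - p) + 2^-1 * enorm (y - p) ^+ 2.
    have -> : 2^-1 * enorm (y - p) ^+ 2 =
        \sum_(i < N) lambda i * (2^-1 * enorm (y - p) ^+ 2).
      by rewrite -mulr_suml lambda1 mul1r.
    rewrite dot_suml mulr_sumr -sumrB -big_split/=; apply: eq_bigr => i _.
    rewrite (_ : x i - y = (x i - p) - (y - p)); last by rewrite opprB addrA subrK.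
    move: (x i - p) (y - p) => u w.
    by rewrite !enorm_sqr !dotE (dotC w u); field.
  by rewrite !enorm_sqr; move: b (y - p) => c w; rewrite !dotE (dotC w c); field.
apply/eqP; rewrite eq_le; apply/andP; split.
  apply: ge_inf.
    exists (2^-1 * Q - 2^-1 * enorm b ^+ 2) => _ [y _ <-].
    by rewrite H lerDl mulr_ge0 ?invr_ge0 ?sqr_ge0.
  exists (b + p) => //; rewrite H addrK subrr enorm0; ring.
apply: lb_le_inf; first by eexists; exists 0.
by move=> _ [y _ <-]; rewrite H lerDl mulr_ge0 ?invr_ge0 ?sqr_ge0.
Qed.

End BarycentricCost.

(** * Borel functions of row vectors and coding by digits *)

Section BorelRowVectors.
Context {R : realType} {n : nat}.

(** Open sets are countable unions of balls with rational centers, and a ball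
    for the sup norm is a finite intersection of conditions on coordinates. *)
Lemma measurable_fun_rV d (X : measurableType d) (A : set X) (f : X -> 'rV[R]_n) :
  (forall j, measurable_fun A (fun x => f x 0 j)) -> measurable_fun A f.
Proof.
move=> mf mA; apply: (@measurability _ _ _ _ _ _ (@open 'rV[R]_n)) => //.
move=> _ [U oU <-]; rewrite (open_bigcup_rat_ball oU) preimage_bigcup setI_bigcupr.
rewrite bigcup_mkcond; apply: countable_bigcupT_measurable; first exact: countableP.
move=> [q k]; case: ifPn => // _.
rewrite (_ : A `&` _ = \bigcap_(j in [set: 'I_n])
    (A `&` (fun x => f x 0 j) @^-1` ball (ratr (q 0 j) : R) k.+1%:R^-1) `&` A).
  apply: measurableI => //; apply: fin_bigcap_measurable => // j _.
  by apply: mf => //; exact: measurable_ball.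
apply/seteqP; split => [x [Ax [k0 /= fx]]|x /= [fx Ax]].
  by split => // j _; split => //=; have := fx 0 j; rewrite !mxE.
have k0 : 0 < k.+1%:R^-1 :> R by rewrite invr_gt0.
split => //; split => // i j; rewrite (ord1 i) !mxE.
by have [] := fx j I.
Qed.

Lemma measurable_fun_coord d (X : measurableType d) (A : set X) (f : X -> 'rV[R]_n) j :
  measurable_fun A f -> measurable_fun A (fun x => f x 0 j).
Proof. by move=> mf; exact: measurableT_comp (measurable_coord j) mf. Qed.

Lemma measurable_fun_enorm d (X : measurableType d) (A : set X) (f : X -> 'rV[R]_n) :
  measurable_fun A f -> measurable_fun A (fun x => enorm (f x)).
Proof.
move=> mf; rewrite /enorm.
have ms := continuous_measurable_fun (@sqrt_continuous R).
apply: (measurableT_comp ms).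
apply: measurable_sum => j; apply: measurable_funX; exact: measurable_fun_coord.
Qed.

Lemma measurable_funD_rV d (X : measurableType d) (A : set X) (f g : X -> 'rV[R]_n) :
  measurable_fun A f -> measurable_fun A g -> measurable_fun A (fun x => f x + g x).
Proof.
move=> mf mg; apply: measurable_fun_rV => j; under eq_fun do rewrite mxE.
by apply: measurable_funD; exact: measurable_fun_coord.
Qed.

Lemma measurable_funZ_rV d (X : measurableType d) (A : set X) (f : X -> 'rV[R]_n) (a : R) :
  measurable_fun A f -> measurable_fun A (fun x => a *: f x).
Proof.
move=> mf; apply: measurable_fun_rV => j; under eq_fun do rewrite mxE.
by apply: measurable_funM => //; exact: measurable_fun_coord.
Qed.

Lemma measurable_funB_rV d (X : measurableType d) (A : set X) (f g : X -> 'rV[R]_n) :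
  measurable_fun A f -> measurable_fun A g -> measurable_fun A (fun x => f x - g x).
Proof.
move=> mf mg; apply: measurable_funD_rV => //.
by under eq_fun do rewrite -scaleN1r; exact: measurable_funZ_rV.
Qed.

Lemma measurable_fun_sum_rV d (X : measurableType d) (A : set X) I (r : seq I)
    (f : I -> X -> 'rV[R]_n) :
  (forall i, measurable_fun A (f i)) -> measurable_fun A (fun x => \sum_(i <- r) f i x).
Proof.
move=> mf; apply: measurable_fun_rV => j; under eq_fun do rewrite summxE.
by apply: measurable_sum => i; exact: measurable_fun_coord.
Qed.

End BorelRowVectors.

Section Digits.
Context {R : realType}.
Implicit Types (b x : R) (c : nat -> bool) (k : nat).

(** The expansions below use the digits 0 and 1 only, in base [b]. The leading
    digit is then read off by comparison with [b^-1], and [digit_tail] removes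
    it and rescales the rest. *)
Definition digit_tail b x : R := b * x - (b^-1 <= x)%R%:R.

Definition digit b k x : bool := b^-1 <= iter k (digit_tail b) x.

Definition digit_sum b c : R := limn (series (fun k => (c k)%:R / b ^+ k.+1)).

Lemma cvg_digit_sum b c : 2 <= b ->
  series (fun k => (c k)%:R / b ^+ k.+1) @ \oo --> digit_sum b c.
Proof.
move=> b2; have b0 : 0 < b by exact: lt_le_trans b2.
suff : cvgn (series (fun k => (c k)%:R / b ^+ k.+1)) by [].
apply: (@series_le_cvg _ _ (geometric b^-1 b^-1)) => [k|k|k|].
- by rewrite divr_ge0 ?exprn_ge0// ltW.
- by rewrite /= mulr_ge0 ?exprn_ge0 ?invr_ge0// ltW.
- rewrite /= -exprS exprVn ler_piMl ?invr_ge0 ?exprn_ge0 ?(ltW b0)//.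
  by rewrite lern1 leq_b1.
- apply: is_cvg_geometric_series; rewrite ger0_norm ?invr_ge0 ?(ltW b0)//.
  by rewrite invf_lt1//; lra.
Qed.

Lemma digit_sumS b c : 2 <= b ->
  digit_sum b c = ((c 0)%:R + digit_sum b (fun k => c k.+1)) / b.
Proof.
move=> b2; have b0 : b != 0 by rewrite gt_eqF//; lra.
apply: cvg_lim => //; rewrite -cvg_shiftS.
rewrite (_ : [sequence _]_n = (fun k => ((c 0)%:R +
   series (fun k => (c k.+1)%:R / b ^+ k.+1) k) / b)).
  apply: cvgM; last exact: cvg_cst.
  by apply: cvgD; [exact: cvg_cst|exact: cvg_digit_sum].
apply/funext => k; rewrite /series/= big_nat_recl//= expr1 mulrDl mulr_suml.
congr (_ + _); apply: eq_bigr => i _.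
by rewrite [in LHS]exprSr invfM mulrA.
Qed.

Lemma digit_sum_ge0 b c : 2 <= b -> 0 <= digit_sum b c.
Proof.
move=> b2; apply: limr_ge; first by apply/cvg_ex; eexists; exact: cvg_digit_sum.
apply: nearW => k; apply: sumr_ge0 => i _.
by rewrite divr_ge0// exprn_ge0//; lra.
Qed.

Lemma digit_sum_le b c : 2 <= b -> digit_sum b c <= (b - 1)^-1.
Proof.
move=> b2; have b0 : 0 < b by exact: lt_le_trans b2.
apply: limr_le; first by apply/cvg_ex; eexists; exact: cvg_digit_sum.
apply: nearW => k.
apply: (@le_trans _ _ (series (geometric b^-1 b^-1) k)).
  apply: ler_sum => i _; rewrite /= -exprS exprVn ler_piMl ?invr_ge0 ?exprn_ge0 ?(ltW b0)//.
  by rewrite lern1 leq_b1.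
have b1 : `|b^-1| < 1.
  by rewrite ger0_norm ?invr_ge0 ?(ltW b0)// invf_lt1//; lra.
apply: le_trans (geometric_le_lim _ _ _ b1) _; rewrite ?invr_ge0 ?invr_gt0 ?(ltW b0)//.
rewrite (_ : _ / _ = (b - 1)^-1)//; field.
by apply/andP; split; rewrite gt_eqF//; lra.
Qed.

(** The partial sums miss [x] by an iterated tail divided by a power of 2,
    and the tails stay in the unit interval. *)
Lemma digit_sum2 x : 0 <= x <= 1 -> digit_sum 2 (digit 2 ^~ x) = x.
Proof.
move=> x01; have iter01 k : 0 <= iter k (digit_tail 2) x <= 1.
  elim: k => // k; rewrite iterS /digit_tail => /andP[]; set y := iter _ _ _ => y0 y1.
  by case: (leP 2^-1 y) => y2 /=; apply/andP; split; lra.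
have sumE k : series (fun k => (digit 2 k x)%:R / 2 ^+ k.+1) k =
    x - iter k (digit_tail 2) x / 2 ^+ k.
  elim: k => [|k IH]; first by rewrite /series/= big_geq// expr0 divr1 subrr.
  rewrite /series/= big_nat_recr//= [X in X + _]IH /digit/= exprS.
  move: (iter k _ x) => y; rewrite /digit_tail.
  by field; rewrite expf_neq0.
apply: cvg_lim => //.
move/funext: sumE => ->.
rewrite -[X in _ --> X]subr0; apply: cvgB; first exact: cvg_cst.
apply: (@squeeze_cvgr _ _ _ _ (cst 0) (fun k => 2^-1 ^+ k)).
- apply: nearW => k; have /andP[y0 y1] := iter01 k.
  by rewrite /= divr_ge0 ?exprn_ge0//= exprVn ler_piMl ?invr_ge0 ?exprn_ge0.
- exact: cvg_cst.
- by apply: cvg_expr; rewrite ger0_norm ?invr_ge0// invf_lt1// ltr1n.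
Qed.

(** In base 4 everything after a digit sums to at most a third of the weight
    of that digit, so that there is no carry and no ambiguity. *)
Lemma digit4_sum c k : digit 4 k (digit_sum 4 c) = c k.
Proof.
have le24 : 2 <= 4 :> R by rewrite ler_nat.
have E c' : (4^-1 <= digit_sum 4 c') = c' 0.
  rewrite digit_sumS//; have := digit_sum_ge0 (fun k => c' k.+1) le24.
  have := digit_sum_le (fun k => c' k.+1) le24.
  set y := digit_sum _ _ => y1 y0; case: (c' 0) => /=; first by lra.
  apply/negbTE; rewrite -ltNge.
  have : (4 - 1)^-1 < 1 :> R by rewrite invf_lt1//; lra.
  lra.
have tailE c' : digit_tail 4 (digit_sum 4 c') = digit_sum 4 (fun i => c' i.+1).
  by rewrite /digit_tail E digit_sumS//; field.
rewrite /digit; elim: k c => [|k IH] c; first exact: E.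
by rewrite iterSr tailE IH.
Qed.

Lemma measurable_fun_nat_of_bool d (X : measurableType d) (A : set X) (f : X -> bool) :
  measurable_fun A f -> measurable_fun A (fun t => (f t)%:R : R).
Proof.
have mnat : measurable_fun [set: bool] (fun e : bool => e%:R : R) by [].
exact: (measurableT_comp mnat).
Qed.

Lemma measurable_digit b k : measurable_fun setT (digit b k).
Proof.
have mtail : measurable_fun setT (digit_tail b).
  apply: measurable_funB; first exact: measurable_funM.
  by apply: measurable_fun_nat_of_bool; exact: measurable_fun_ler.
apply: measurable_fun_ler => //; elim: k => [|k IH].
  exact: measurable_id.
exact: (measurableT_comp mtail).
Qed.

Lemma measurable_digit_sum d (X : measurableType d) (A : set X) b (c : X -> nat -> bool) :
  2 <= b -> (forall k, measurable_fun A (c ^~ k)) ->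
  measurable_fun A (fun t => digit_sum b (c t)).
Proof.
move=> b2 mc.
apply: (@measurable_fun_cvg _ _ _ _ (fun K t => series (fun k => (c t k)%:R / b ^+ k.+1) K)).
  move=> K; apply: measurable_sum => k; apply: measurable_funM => //.
  exact: measurable_fun_nat_of_bool.
by move=> x _; exact: cvg_digit_sum.
Qed.

(** Interleave the base 2 digits of the (rescaled) coordinates of a vector and
    use them as the base 4 digits of a single real number. This reduces the
    transport of measures on row vectors to the real line. *)
Lemma exists_borel_code n (M : R) : 0 < M ->
  exists (code : 'rV[R]_n.+1 -> R) (decode : R -> 'rV[R]_n.+1),
  [/\ measurable_fun setT code, measurable_fun setT decode,
      forall v, 0 <= code v <= 1 &
      forall v : 'rV[R]_n.+1, (forall j, `|v 0 j| <= M) -> decode (code v) = v].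
Proof.
move=> M0.
have le24 : 2 <= 4 :> R by rewrite ler_nat.
pose unit_coord (v : 'rV[R]_n.+1) j := (v 0 j + M) / (2 * M).
exists (fun v => digit_sum 4 (fun k => digit 2 (k %/ n.+1) (unit_coord v (inord (k %% n.+1))))).
exists (fun t => \row_j (2 * M * digit_sum 2 (fun k => digit 4 (k * n.+1 + j) t) - M)).
split.
- apply: measurable_digit_sum => // k.
  apply: (measurableT_comp (measurable_digit _ _)).
  apply: measurable_funM => //; apply: measurable_funD => //.
  exact: measurable_coord.
- apply: measurable_fun_rV => j; under eq_fun do rewrite mxE.
  apply: measurable_funB => //; apply: measurable_funM => //.
  by apply: measurable_digit_sum => // k; exact: measurable_digit.
- move=> x; rewrite digit_sum_ge0//=; apply: le_trans (digit_sum_le _ le24) _.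
  by rewrite invf_le1; lra.
- move=> x xM; apply/rowP => j; rewrite mxE.
  have -> : (fun k => digit 4 (k * n.+1 + j) (digit_sum 4 (fun k =>
      digit 2 (k %/ n.+1) (unit_coord x (inord (k %% n.+1)))))) = digit 2 ^~ (unit_coord x j).
    apply/funext => k; rewrite digit4_sum divnMDl// divn_small// addn0.
    by rewrite modnMDl modn_small// inord_val.
  rewrite digit_sum2 /unit_coord; first by field; rewrite gt_eqF.
  have := xM j; rewrite ler_norml => /andP[xM1 xM2].
  rewrite divr_ge0 ?ler_pdivrMr ?mul1r//=; try lra.
Qed.

End Digits.

(** * Monotone rearrangement on the real line *)

Section Rearrangement.
Context {R : realType}.
Local Open Scope ereal_scope.

Lemma exists_image_measure d d' (X : measurableType d) (Y : measurableType d')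
    (mu : {measure set X -> \bar R}) (f : X -> Y) : measurable_fun setT f ->
  exists nu : {measure set Y -> \bar R}, forall A, nu A = mu (f @^-1` A).
Proof.
move=> mf; pose nu := [the {measure set Y -> \bar R} of pushforward mu f].
by exists (nu mf).
Qed.

Lemma measure_split d (X : measurableType d) (mu : {measure set X -> \bar R}) A :
  measurable A -> mu setT = mu A + mu (~` A).
Proof.
move=> mA; rewrite -measureU ?setUv ?setICr//; exact: measurableC.
Qed.

(** A nonempty down-closed set of reals is an increasing union of half-lines
    whose endpoints belong to it. *)
Lemma measure_downset_le (mu : {measure set R -> \bar R}) (Z : set R) c :
  (forall s t, Z s -> (t <= s)%R -> Z t) -> 0 <= c ->
  (forall s, Z s -> mu `]-oo, s]%classic <= c) -> mu Z <= c.
Proof.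
move=> downZ c0 Zc; have [->|/set0P[z0 Zz0]] := eqVneq Z set0.
  by rewrite measure0.
suff [s [nds sZ Zs]] : exists s : nat -> R, [/\ nondecreasing_seq s,
    forall k, Z (s k) & forall z, Z z -> exists k, (z <= s k)%R].
  have ZE : Z = \bigcup_k `]-oo, s k]%classic.
    apply/seteqP; split=> [z /Zs[k zk]|z [k _ /=]]; last first.
      by rewrite in_itv/=; exact: downZ.
    by exists k => //=; rewrite in_itv.
  have cvgs : mu \o (fun k => `]-oo, s k]%classic) @ \oo --> mu Z.
    rewrite ZE; apply: nondecreasing_cvg_mu.
    - by move=> k; exact: measurable_itv.
    - by apply: bigcupT_measurable => k; exact: measurable_itv.
    - by move=> i j ij; apply/subsetPset; apply: subset_itvl; rewrite bnd_simp nds.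
  rewrite -(cvg_lim _ cvgs)//; apply: lime_le; first by apply/cvg_ex; eexists; exact: cvgs.
  by apply: nearW => k /=; exact: Zc.
have [ubZ|nubZ] := pselect (has_ubound Z); last first.
  exists (fun k => k%:R); split=> [i j ij|k|z _]; first by rewrite ler_nat.
    have [z [Zz kz]] : exists z, Z z /\ (k%:R <= z)%R.
      apply: contrapT => nex; apply: nubZ; exists k%:R => z Zz.
      by rewrite leNgt; apply/negP => kz; apply: nex; exists z; split => //; exact: ltW.
    exact: downZ kz.
  by exists (Num.bound `|z|%R); apply: le_trans (ler_norm z) (ltW _); exact: archi_boundP.
have supZ : has_sup Z by split => //; exists z0.
have [Zsup|nZsup] := pselect (Z (sup Z)).
  by exists (fun=> sup Z); split=> // z Zz; exists 0%N; exact: ub_le_sup.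
exists (fun k => sup Z - k.+1%:R^-1)%R; split=> [i j ij|k|z Zz].
- by rewrite lerB// lef_pV2 ?posrE// ler_nat ltnS.
- have k0 : (0 < k.+1%:R^-1 :> R)%R by rewrite invr_gt0.
  have [z Zz zk] := sup_adherent k0 supZ.
  by apply: downZ Zz _; exact: ltW.
- have e0 : (0 < sup Z - z)%R.
    rewrite subr_gt0 lt_neqAle ub_le_sup// andbT.
    by apply/eqP => zE; apply: nZsup; rewrite -zE.
  have [k _ /(_ _ (leqnn _)) /= kP] := near_infty_natSinv_lt (PosNum e0).
  by exists k; rewrite lerBrDr addrC -lerBrDr ltW.
Qed.

Lemma measure_upset_le (mu : {measure set R -> \bar R}) (Z : set R) c :
  (forall s t, Z s -> (s <= t)%R -> Z t) -> 0 <= c ->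
  (forall s, Z s -> mu `[s, +oo[%classic <= c) -> mu Z <= c.
Proof.
move=> upZ c0 Zc.
have mN : measurable_fun setT (-%R : R -> R) by exact: oppr_measurable.
have [nu nuE] := exists_image_measure mu mN.
have := @measure_downset_le nu ((-%R : R -> R) @` Z) c.
rewrite !nuE (_ : -%R @^-1` (-%R @` Z) = Z); last first.
  apply/seteqP; split=> [z [y Zy /oppr_inj<-]//|z Zz]; by exists z.
apply=> // [_ t [s Zs <-] ts|_ [s Zs <-]].
  by exists (- t)%R; rewrite ?opprK//; apply: upZ Zs _; rewrite lerNr.
rewrite nuE (_ : _ @^-1` _ = `[s, +oo[%classic); first exact: Zc.
by apply/seteqP; split=> z /=; rewrite !in_itv/= lerN2 andbT.
Qed.

(** Pushed forward by its own distribution function, an atomless law becomes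
    uniform. A sublevel set of the distribution function is a down-set made of
    half-lines of mass at most [c]; its complement is an up-set made of
    half-lines which, for lack of atoms, have mass at most [mu setT - c]. *)
Lemma atomless_cdf_uniform (mu : {measure set R -> \bar R}) c :
  (forall s, mu [set s] = 0) -> mu setT < +oo -> 0 <= c <= mu setT ->
  mu [set s | mu `]-oo, s]%classic <= c] = c.
Proof.
move=> mu1 muoo /andP[c0 cT].
set Z := [set s | _ <= c].
have downZ s t : Z s -> (t <= s)%R -> Z t.
  move=> Zs ts; apply: le_trans Zs; apply: le_measure; rewrite ?inE//.
  by apply: subset_itvl; rewrite bnd_simp.
have mZ : measurable Z.
  by apply: is_interval_measurable => x y _ Zy z /andP[_ zy]; exact: downZ zy.
have fin_mu A : measurable A -> mu A \is a fin_num.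
  move=> mA; rewrite ge0_fin_numE//; apply: le_lt_trans muoo.
  by apply: le_measure; rewrite ?inE.
have finc : c \is a fin_num by rewrite ge0_fin_numE// (le_lt_trans cT).
apply/eqP; rewrite eq_le; apply/andP; split.
  exact: measure_downset_le.
have : mu (~` Z) <= mu setT - c.
  apply: measure_upset_le => [s t nZs st Zt||s]; first by apply: nZs; exact: downZ st.
    by rewrite sube_ge0// ?finc//.
  move=> /negP; rewrite -ltNge => sc.
  have ms : measurable (`]-oo, s[%classic : set R) by exact: measurable_itv.
  have E1 : mu `]-oo, s]%classic = mu `]-oo, s[%classic.
    rewrite -(@setUitv1 _ _ _ _ true)//= measureU//= ?mu1 ?adde0//.
    by apply/seteqP; split=> // x [/= xs xE]; move: xs; rewrite xE in_itv/= ltxx.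
  rewrite (measure_split mu ms) setCitvl.
  rewrite [X in X - _]addeC -addeA leeDl// sube_ge0 ?finc// -E1; exact: ltW.
rewrite (measure_split mu mZ).
have := fin_mu _ mZ; have := fin_mu _ (measurableC mZ).
move: (mu Z) (mu (~` Z)) finc => [a||] [b||] // + _ _; case: (c) => [r||]// _.
by rewrite -?EFinD -?EFinB -?EFinD !lee_fin => H; lra.
Qed.

Lemma eq_measure_rays (mu nu : {measure set R -> \bar R}) :
  mu setT < +oo -> mu setT = nu setT ->
  (forall t, mu `]-oo, t]%classic = nu `]-oo, t]%classic) ->
  forall A, measurable A -> mu A = nu A.
Proof.
move=> muoo muT munu.
have fin_mu A : measurable A -> mu A \is a fin_num.
  move=> mA; rewrite ge0_fin_numE//; apply: le_lt_trans muoo.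
  by apply: le_measure; rewrite ?inE.
have mray t : measurable (`]-oo, t]%classic : set R) by exact: measurable_itv.
have munu' t : mu `]t, +oo[%classic = nu `]t, +oo[%classic.
  have fint : nu `]-oo, t]%classic \is a fin_num by rewrite -munu fin_mu.
  rewrite -setCitvl -[LHS](addeK _ fint) -[RHS](addeK _ fint) 2!(addeC _ (nu `]-oo, t]%classic)).
  by rewrite -{1}munu -measure_split// muT (measure_split nu (mray t)).
move=> A mA.
apply: (@g_sigma_algebra_measure_unique _ _ _ (@RGenOInfty.G R) _
  (fun k => `](- k%:R)%R, +oo[%classic)).
- by move=> _ [x ->]; exact: measurable_itv.
- by move=> k; exists (- k%:R)%R.
- rewrite -subTset => x _; exists (Num.bound `|x|%R) => //=.
  rewrite in_itv/= andbT ltrNl; apply: le_lt_trans (ler_norm _) _.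
  by rewrite normrN; exact: archi_boundP.
- move=> _ _ [x ->] [y ->]; exists (Num.max x y).
  by apply/seteqP; split=> z /=; rewrite !in_itv/= !andbT gt_max => /andP.
- by move=> _ [x ->].
- by move=> k; rewrite ltey_eq fin_mu.
- suff : (@RGenOInfty.G R).-sigma.-measurable A by [].
  by rewrite -RGenOInfty.measurableE.
Qed.

(** The monotone rearrangement: a point is sent to the quantile of [nu] at the
    level given by the distribution function of [mu]. By
    [atomless_cdf_uniform] the image law has the same distribution function as
    [nu]. *)
Lemma exists_rearrangement (mu nu : {measure set R -> \bar R}) :
  (forall s, mu [set s] = 0) -> mu setT < +oo -> mu setT = nu setT ->
  nu (~` `[0%R, 1%R]%classic) = 0 ->
  exists2 M : R -> R, measurable_fun setT M &
    forall A, measurable A -> mu (M @^-1` A) = nu A.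
Proof.
move=> mu1 muoo muT nu01.
have mray t : measurable (`]-oo, t]%classic : set R) by exact: measurable_itv.
pose F s := mu `]-oo, s]%classic; pose G t := nu `]-oo, t]%classic.
have ndG x y : (x <= y)%R -> G x <= G y.
  move=> xy; apply: le_measure; rewrite ?inE//.
  by apply: subset_itvl; rewrite bnd_simp.
have ndF x y : (x <= y)%R -> F x <= F y.
  move=> xy; apply: le_measure; rewrite ?inE//.
  by apply: subset_itvl; rewrite bnd_simp.
have GleT t : G t <= mu setT.
  by rewrite muT; apply: le_measure; rewrite ?inE.
have m01 : measurable (~` `[0%R, 1%R]%classic : set R).
  by apply: measurableC; exact: measurable_itv.
have G0 t : (t < 0)%R -> G t = 0.
  move=> t0; apply/eqP; rewrite eq_le measure_ge0 andbT -nu01.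
  apply: le_measure; rewrite ?inE// => x /=; rewrite !in_itv/= => xt.
  by move=> /andP[x0 _]; move: (lt_le_trans t0 (le_trans x0 xt)); rewrite ltxx.
have FG1 s : F s <= G 1%R.
  apply: (@le_trans _ _ (mu setT)); first by apply: le_measure; rewrite ?inE.
  rewrite muT (measure_split nu (mray 1%R)) setCitvl [X in _ + X](_ : _ = 0) ?adde0//.
  apply/eqP; rewrite eq_le measure_ge0 andbT -nu01.
  apply: le_measure; rewrite ?inE//.
  move=> x /=; rewrite !in_itv/= andbT => x1 /andP[_].
  by rewrite leNgt x1.
pose Q s := [set t | (0 <= t)%R /\ F s <= G t].
have lbQ s : has_lbound (Q s) by exists 0%R => t [].
have Qn0 s : Q s !=set0 by exists 1%R; split.
pose M s := inf (Q s).
have M0 s : (0 <= M s)%R by apply: lb_le_inf => // t [].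
(* The infimum is attained, as [G] is right continuous. *)
have QM s : F s <= G (M s).
  have cvgG : nu \o (fun k => `]-oo, (M s + k.+1%:R^-1)%R]%classic) @ \oo --> G (M s).
    rewrite /G (_ : `]-oo, M s]%classic = \bigcap_k `]-oo, (M s + k.+1%:R^-1)%R]%classic).
      apply: nonincreasing_cvg_mu => //.
      - by apply: le_lt_trans muoo; exact: GleT.
      - by apply: bigcapT_measurable.
      - move=> i j ij; apply/subsetPset; apply: subset_itvl; rewrite bnd_simp.
        by rewrite lerD2l lef_pV2 ?posrE// ler_nat ltnS.
    apply/seteqP; split=> [x /=|x Hx /=].
      rewrite in_itv/= => xM k _ /=; rewrite in_itv/=.
      by apply: le_trans xM _; rewrite lerDl.
    rewrite in_itv/=; apply/ler_addgt0Pl => e e0.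
    have [k _ /(_ _ (leqnn _)) /= kP] := near_infty_natSinv_lt (PosNum e0).
    have := Hx k I; rewrite /= in_itv/= => /le_trans; apply.
    by rewrite addrC lerD2r ltW.
  rewrite -(cvg_lim _ cvgG)//; apply: lime_ge; first by apply/cvg_ex; eexists; exact: cvgG.
  apply: nearW => k /=.
  have k0 : (0 < k.+1%:R^-1 :> R)%R by rewrite invr_gt0.
  have [t [t0 FGt] tM] := inf_adherent k0 (conj (Qn0 s) (lbQ s)).
  by apply: le_trans FGt _; apply: ndG; exact: ltW.
have MleP t : (0 <= t)%R -> [set s | (M s <= t)%R] = [set s | F s <= G t].
  move=> t0; apply/seteqP; split=> s /= => [Mt|FGt].
    by apply: le_trans (QM s) _; exact: ndG.
  by apply: ge_inf.
have MltP t : (t < 0)%R -> [set s | (M s <= t)%R] = set0.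
  move=> t0; rewrite -subset0 => s /= /(le_trans (M0 s)).
  by rewrite leNgt t0.
have mM : measurable_fun setT M.
  apply: (@measurability _ _ _ _ _ _ (@RGenOInfty.G R)).
    exact: RGenOInfty.measurableE.
  move=> _ [_ [t ->] <-]; rewrite setTI.
  rewrite (_ : _ @^-1` _ = ~` [set s | (M s <= t)%R]).
    apply: measurableC; have [t0|t0] := leP 0%R t; last by rewrite MltP.
    rewrite MleP//; apply: is_interval_measurable => x y _ Fy z /andP[_ zy].
    by apply: le_trans Fy; exact: ndF.
  apply/seteqP; split=> s /=; rewrite in_itv/= andbT ltNge; first by move/negP.
  by move/negP.
exists M => //.
have [nu' nu'E] := exists_image_measure mu mM.
move=> A mA; rewrite -nu'E; apply: eq_measure_rays => //.
- by rewrite nu'E preimage_setT.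
- by rewrite nu'E preimage_setT.
move=> t; rewrite nu'E (_ : _ @^-1` _ = [set s | (M s <= t)%R]); last first.
  by apply/seteqP; split=> s /=; rewrite in_itv.
have [t0|t0] := leP 0%R t.
  by rewrite MleP// atomless_cdf_uniform// measure_ge0/= GleT.
by rewrite MltP// measure0 -[RHS]/(G t) G0.
Qed.

End Rearrangement.

(** * Transport maps from atomless measures *)

Section TransportMaps.
Context {R : realType}.
Local Open Scope ereal_scope.

Lemma eq_measure_on d (X : measurableType d) (mu : {measure set X -> \bar R})
    (K A B : set X) :
  measurable K -> measurable A -> measurable B -> mu (~` K) = 0 ->
  (forall x, K x -> A x <-> B x) -> mu A = mu B.
Proof.
move=> mK mA mB K0 AB.
have H C : measurable C -> mu C = mu (C `&` K).
  move=> mC; rewrite (measureDI mu mC mK) [X in X + _](_ : _ = 0) ?add0e//.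
  apply/eqP; rewrite eq_le measure_ge0 andbT -K0.
  apply: le_measure; rewrite ?inE; [exact: measurableD|exact: measurableC|].
  by move=> x [].
rewrite H// [RHS]H//; congr (mu _).
by apply/seteqP; split=> x [Cx Kx]; split => //; apply/(AB x Kx).
Qed.

(** Rearrange on the line the law of the atomless function [u] into the law of
    a Borel code of the target space, then decode. *)
Lemma exists_transport d (X : measurableType d) (mu : {measure set X -> \bar R})
    (u : X -> R) n (nu : {measure set 'rV[R]_n.+1 -> \bar R}) (K : set 'rV[R]_n.+1) M :
  measurable_fun setT u -> (forall s, mu (u @^-1` [set s]) = 0) ->
  mu setT < +oo -> mu setT = nu setT ->
  measurable K -> K !=set0 -> (forall y j, K y -> (`|y 0 j| <= M)%R) -> nu (~` K) = 0 ->
  exists f : X -> 'rV[R]_n.+1, [/\ measurable_fun setT f, forall x, K (f x) &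
    forall A, measurable A -> mu (f @^-1` A) = nu A].
Proof.
move=> mu_ u0 muoo munu mK [y0 Ky0] KM nuK.
have M0 : (0 < `|M| + 1)%R by rewrite ltr_wpDl.
have [code [decode [mcode mdecode code01 codeK]]] := exists_borel_code n M0.
pose proj y := if y \in K then y else y0.
have mproj : measurable_fun setT proj.
  apply: measurable_fun_ifT => //.
  by apply: (measurable_fun_bool true); rewrite setTI preimage_mem_true.
have Kproj y : K (proj y) by rewrite /proj; case: ifPn => [/set_mem|].
have [mu' mu'E] := exists_image_measure mu mu_.
have [nu' nu'E] := exists_image_measure nu mcode.
have [||||N mN NE] := @exists_rearrangement _ mu' nu'.
- by move=> s; rewrite mu'E u0.
- by rewrite mu'E preimage_setT.
- by rewrite mu'E nu'E !preimage_setT.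
- rewrite nu'E (_ : _ @^-1` _ = set0) ?measure0//.
  by rewrite -subset0 => y /=; rewrite in_itv/= code01.
exists (proj \o decode \o N \o u).
have mpd : measurable_fun setT (proj \o decode) by exact: measurableT_comp.
split => [|x|A mA].
- apply: measurableT_comp => //; exact: measurableT_comp.
- exact: Kproj.
have mB : measurable ((proj \o decode) @^-1` A) by rewrite -[X in measurable X]setTI; exact: mpd.
rewrite -[LHS]/(mu (u @^-1` (N @^-1` ((proj \o decode) @^-1` A)))).
rewrite -mu'E NE// nu'E; apply: (eq_measure_on mK) => //.
  by rewrite -[X in measurable X]setTI; exact: mcode.
move=> y Ky /=; rewrite codeK; last first.
  move=> j; apply: le_trans (KM _ j Ky) _; apply: le_trans (ler_norm _) _.
  by rewrite lerDl.
by rewrite /proj mem_set.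
Qed.

(** This replaces a coupling by a map. Partition the range of [U] into small
    cells. On the part of [X] that [U] sends to a given cell, a transport map
    realizes the law of [p] restricted to the event that [q] is in that cell.
    Glued together, these maps have, jointly with the cell of [U], the law of
    [p] jointly with the cell of [q]; and a cell determines a point of it up
    to half of [e]. *)
Lemma exists_transport_near d (X : measurableType d) (mu : probability X R)
    (u : X -> R) d' (Om : measurableType d') (gamma : probability Om R)
    n (p q : Om -> 'rV[R]_n.+1) (U : X -> 'rV[R]_n.+1) (K : set 'rV[R]_n.+1) M (e : R) :
  measurable_fun setT u -> (forall s, mu (u @^-1` [set s]) = 0) ->
  measurable_fun setT p -> measurable_fun setT q -> measurable_fun setT U ->
  measurable K -> K !=set0 -> (forall y j, K y -> (`|y 0 j| <= M)%R) ->
  gamma (p @^-1` (~` K)) = 0 ->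
  (forall A, measurable A -> mu (U @^-1` A) = gamma (q @^-1` A)) ->
  (0 < e)%R ->
  exists V : X -> 'rV[R]_n.+1, [/\ measurable_fun setT V, forall x, K (V x),
    forall A, measurable A -> mu (V @^-1` A) = gamma (p @^-1` A) &
    \int[mu]_x (enorm (V x - U x))%:E <=
      \int[gamma]_w (enorm (p w - q w))%:E + e%:E].
Proof.
move=> mu_ u0 mp mq mU mK K0 KM pK UE e0.
have pre d1 d2 (T1 : measurableType d1) (T2 : measurableType d2) (f : T1 -> T2) A :
    measurable_fun setT f -> measurable A -> measurable (f @^-1` A).
  by move=> mf mA; rewrite -[X in measurable X]setTI; exact: mf.
(* Sup-norm balls of radius [del] have Euclidean radius at most [e / 2]. *)
pose del := (e / 2 / n.+1%:R)%R.
have del0 : (0 < del)%R by rewrite /del !divr_gt0.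
pose c k : 'rV[R]_n.+1 := map_mx ratr (odflt 0%R (unpickle k) : 'rV[rat]_n.+1).
pose B k := ball (c k) del.
have mB k : measurable (B k) by apply: open_measurable_rV; exact: ball_open.
pose Q := seqDU B.
have mQ k : measurable (Q k) by exact: seqDU_measurable.
have [lab labQ] : {lab : 'rV[R]_n.+1 -> nat & forall y, Q (lab y) y}.
  apply: (@choice _ _ (fun y k => Q k y)) => y; have [r ry] := rat_ball_near y del0.
  have : (\bigcup_k B k) y by exists (pickle r) => //; rewrite /B /c pickleK.
  by rewrite seqDU_bigcup_eq => -[k _ Qky]; exists k.
have labE y k : Q k y -> lab y = k.
  by move=> Qky; apply: (trivIset_seqDU B _ _ I I); exists y; split => //; exact: labQ.
have lab_near y : (enorm (y - c (lab y)) <= e / 2)%R.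
  have [_ yB] : B (lab y) y by apply: subset_seqDU; exact: labQ.
  rewrite (_ : e / 2 = n.+1%:R * del)%R; last by rewrite /del; field.
  apply: enorm_le_coord => [|j]; first exact: ltW.
  by have := yB 0%R j; rewrite /ball/= !mxE distrC => /ltW.
have mlab : measurable_fun setT lab.
  move=> _ A _; rewrite setTI (_ : _ @^-1` _ = \bigcup_(k in A) Q k).
    exact: bigcup_measurable.
  apply/seteqP; split=> [y Ay|y [k Ak Qky]]; first by exists (lab y).
  by rewrite /= (labE _ _ Qky).
have exf k : exists f : X -> 'rV[R]_n.+1, [/\ measurable_fun setT f, forall x, K (f x) &
    forall A, measurable A ->
      mu (f @^-1` A `&` U @^-1` Q k) = gamma (p @^-1` A `&` q @^-1` Q k)].
  have mUQ : measurable (U @^-1` Q k) by exact: pre.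
  have mqQ : measurable (q @^-1` Q k) by exact: pre.
  have [nu nuE] := exists_image_measure [the {measure set Om -> \bar R} of mrestr gamma mqQ] mp.
  have [||||f [mf fK fE]] := @exists_transport _ _
    [the {measure set X -> \bar R} of mrestr mu mUQ] u n nu K M mu_ _ _ _ mK K0 KM.
  - move=> s; apply/eqP; rewrite eq_le measure_ge0 andbT -[leRHS](u0 s).
    by apply: le_measure; rewrite ?inE//; [apply: measurableI => //|]; exact: pre.
  - by apply: le_lt_trans (probability_le1 mu _) (ltry _) => //; exact: measurableI.
  - by rewrite nuE preimage_setT/= /mrestr !setTI UE.
  - rewrite nuE/= /mrestr; apply/eqP; rewrite eq_le measure_ge0 andbT -pK.
    have mpK : measurable (p @^-1` (~` K)) by apply: pre => //; exact: measurableC.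
    by apply: le_measure; rewrite ?inE//; exact: measurableI.
  exists f; split=> // A mA; have := fE A mA; rewrite nuE.
  by [].
have [f fP] := choice exf.
pose V x := f (lab (U x)) x.
have mV : measurable_fun setT V.
  move=> _ A mA; rewrite setTI.
  rewrite (_ : _ @^-1` _ = \bigcup_k (f k @^-1` A `&` U @^-1` Q k)).
    apply: bigcupT_measurable => k; have [mf _ _] := fP k.
    by apply: measurableI; exact: pre.
  apply/seteqP; split=> [x Ax|x [k _ [/= Ax Qk]]].
    by exists (lab (U x)) => //; split => //; exact: labQ.
  by rewrite /V /= (labE _ _ Qk).
have mVl : measurable_fun setT (fun x => (V x, lab (U x))).
  by apply: measurable_fun_pair => //; exact: measurableT_comp.
have mpl : measurable_fun setT (fun w => (p w, lab (q w))).
  by apply: measurable_fun_pair => //; exact: measurableT_comp.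
have [m1 m1E] := exists_image_measure mu mVl.
have [m2 m2E] := exists_image_measure gamma mpl.
have m12 C : measurable C -> m1 C = m2 C.
  move=> mC; pose Ck k := (fun y => (y, k)) @^-1` C.
  have mCk k : measurable (Ck k) by apply: pre mC; exact: pair2_measurable.
  (* Split both preimages along the countably many values of the cell. *)
  rewrite m1E m2E.
  rewrite (_ : _ @^-1` C = \bigcup_k (f k @^-1` Ck k `&` U @^-1` Q k)); last first.
    apply/seteqP; split=> [x Cx|x [k _ [/= Cx Qk]]].
      by exists (lab (U x)) => //; split => //; exact: labQ.
    by rewrite /V (labE _ _ Qk).
  rewrite [in RHS](_ : _ @^-1` C = \bigcup_k (p @^-1` Ck k `&` q @^-1` Q k)); last first.
    apply/seteqP; split=> [x Cx|x [k _ [/= Cx Qk]]].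
      by exists (lab (q x)) => //; split => //; exact: labQ.
    by rewrite (labE _ _ Qk).
  have tQ T (g : T -> 'rV[R]_n.+1) (D : nat -> set T) :
      trivIset setT (fun k => D k `&` g @^-1` Q k).
    by apply/trivIsetP => i j _ _; apply: contraNeq => /set0P[x [[_ Qi] [_ Qj]]];
       rewrite -(labE _ _ Qi) -(labE _ _ Qj).
  have mfQ k : measurable (f k @^-1` Ck k `&` U @^-1` Q k).
    by have [mf _ _] := fP k; apply: measurableI; exact: pre.
  have mpQ k : measurable (p @^-1` Ck k `&` q @^-1` Q k).
    by apply: measurableI; exact: pre.
  rewrite !measure_semi_bigcup//; try exact: bigcupT_measurable.
  by apply: eq_eseriesr => k _; have [_ _ H] := fP k; exact: H.
exists V; split=> // [x|A mA|].
- by have [_ + _] := fP (lab (U x)); exact.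
- have := m12 (A `*` setT) (measurableX mA measurableT); rewrite m1E m2E.
  have -> : (fun x => (V x, lab (U x))) @^-1` (A `*` setT) = V @^-1` A.
    by apply/seteqP; split=> x //= [].
  have -> : (fun w => (p w, lab (q w))) @^-1` (A `*` setT) = p @^-1` A.
    by apply/seteqP; split=> x //= [].
  by [].
pose h (z : 'rV[R]_n.+1 * nat) := (enorm (z.1 - c z.2))%:E.
have mh : measurable_fun setT h.
  apply/measurable_EFinP; apply: measurable_fun_enorm; apply: measurable_funB_rV => //.
  have mc : measurable_fun setT c by [].
  exact: (measurableT_comp mc).
have h0 z : 0 <= h z by rewrite lee_fin enorm_ge0.
have hE : \int[mu]_x h (V x, lab (U x)) = \int[gamma]_w h (p w, lab (q w)).
  pose Vl x := (V x, lab (U x)); pose pl w := (p w, lab (q w)).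
  rewrite -[LHS]/(\int[mu]_(x in Vl @^-1` setT) (h \o Vl) x).
  rewrite -[RHS]/(\int[gamma]_(w in pl @^-1` setT) (h \o pl) w).
  rewrite -!ge0_integral_pushforward//.
  by apply: eq_measure_integral => C mC _; have := m12 C mC; rewrite m1E m2E.
have int_le_add d0 (T : measurableType d0) (P : probability T R) (a b : T -> R) :
    measurable_fun setT a -> measurable_fun setT b ->
    (forall x, 0 <= a x)%R -> (forall x, 0 <= b x)%R ->
    (forall x, a x <= b x + e / 2)%R ->
    \int[P]_x (a x)%:E <= \int[P]_x (b x)%:E + (e / 2)%:E.
  move=> ma mb a0 b0 ab; have e20 : (0 <= e / 2)%R by rewrite divr_ge0// ltW.
  have -> : (e / 2)%:E = \int[P]_x (e / 2)%:E.
    by rewrite integral_cst//= probability_setT mule1.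
  rewrite -ge0_integralD//; last 2 first.
  - by move=> x _; rewrite lee_fin.
  - exact/measurable_EFinP.
  apply: ge0_le_integral => //.
  - by move=> x _; rewrite lee_fin.
  - exact/measurable_EFinP.
  - by apply: emeasurable_funD => //; exact/measurable_EFinP.
  - by move=> x _; rewrite -EFinD lee_fin.
have mhV : measurable_fun setT (fun x => enorm (V x - c (lab (U x)))).
  by apply/measurable_EFinP; exact: (measurableT_comp mh mVl).
have mhp : measurable_fun setT (fun w => enorm (p w - c (lab (q w)))).
  by apply/measurable_EFinP; exact: (measurableT_comp mh mpl).
have mVU : measurable_fun setT (fun x => enorm (V x - U x)).
  by apply: measurable_fun_enorm; exact: measurable_funB_rV.
have mpq : measurable_fun setT (fun w => enorm (p w - q w)).
  by apply: measurable_fun_enorm; exact: measurable_funB_rV.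
have tri (y z w : 'rV[R]_n.+1) : (enorm (y - z) <= enorm (y - w) + enorm (w - z))%R.
  by rewrite (_ : y - z = y - w + (w - z))%R ?ler_enormD// addrA subrK.
apply: (@le_trans _ _ (\int[mu]_x h (V x, lab (U x)) + (e / 2)%:E)).
  apply: int_le_add => // [x|x|x]; rewrite ?enorm_ge0//.
  apply: le_trans (tri _ _ (c (lab (U x)))) _.
  by rewrite lerD2l enormB lab_near.
have -> : e%:E = (e / 2)%:E + (e / 2)%:E by rewrite -EFinD -splitr.
rewrite hE addeA; apply: leeD2r.
apply: int_le_add => // [x|x|x]; rewrite ?enorm_ge0//.
apply: le_trans (tri _ _ (q x)) _.
by rewrite lerD2l lab_near.
Qed.

End TransportMaps.

(** * Replacing one point in the cost; hyperplanes and diameters *)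

Section Replacement.
Context {R : realType} {n : nat}.
Local Notation E := 'rV[R]_n.

(** Twice the cost is, up to a function of each argument alone, minus the
    squared norm of the barycenter, which [v] enters affinely. The first
    correction has mean zero when [v] and [x k] have the same law; the other
    one is strictly convex in [v - x k]. *)
Lemma barycentric_cost_replace N (lambda : 'I_N -> R) (x : 'I_N -> E) k (v p : E) :
  \sum_(j < N) lambda j = 1 ->
  2 * barycentric_cost lambda (fun j => if j == k then v else x j) =
  2 * barycentric_cost lambda x
  + lambda k * (enorm (v - p) ^+ 2 - enorm (x k - p) ^+ 2)
  - (2 * lambda k * dot (\sum_(j < N) lambda j *: x j - p) (v - x k)
     + lambda k ^+ 2 * enorm (v - x k) ^+ 2).
Proof.
move=> l1; rewrite !(barycentric_costE l1 _ p).
rewrite [in LHS](bigD1 k)//= [X in _ - 2^-1 * enorm (X - p) ^+ 2](bigD1 k)//= eqxx.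
rewrite (eq_bigr (fun j => lambda j * enorm (x j - p) ^+ 2)); last first.
  by move=> j /negPf ->.
rewrite [X in _ *: v + X](eq_bigr (fun j => lambda j *: x j)); last first.
  by move=> j /negPf ->.
rewrite [in RHS](bigD1 k)//=; set b := \sum_(j < N) _ *: _.
rewrite (_ : lambda k *: v + _ - p = b - p + lambda k *: (v - x k)); last first.
  rewrite /b [in RHS](bigD1 k)//= scalerBr.
  by rewrite [RHS]addrC -[X in _ = _ + X]addrA [RHS]addrA subrK addrA.
move: (b - p) (v - x k) (\sum_(i < N | _) _) => c w s.
rewrite (enorm_sqr (c + _)) !dotE (dotC w c) -!enorm_sqr.
by field.
Qed.

(** On a bounded set the correction of [barycentric_cost_replace] depends on
    the replacement in a Lipschitz way, with a constant proportional to the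
    weight. *)
Lemma replacement_lipschitz (lam D : R) (b t u v : E) :
  0 <= lam <= 1 -> enorm b <= D -> enorm (u - t) <= D -> enorm (v - t) <= D ->
  2 * lam * dot b (u - t) + lam ^+ 2 * enorm (u - t) ^+ 2 <=
  2 * lam * dot b (v - t) + lam ^+ 2 * enorm (v - t) ^+ 2
  + 4 * D * lam * enorm (v - u).
Proof.
move=> /andP[l0 l1] bD uD vD.
have D0 : 0 <= D by exact: le_trans (enorm_ge0 _) bD.
have H1 : dot b (u - v) <= D * enorm (v - u).
  apply: le_trans (dot_le_enorm _ _) _; rewrite enormB.
  by rewrite ler_wpM2r ?enorm_ge0.
have H2 : dot (u - v) ((u - t) + (v - t)) <= enorm (v - u) * (2 * D).
  apply: le_trans (dot_le_enorm _ _) _; rewrite enormB.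
  rewrite ler_wpM2l ?enorm_ge0//; apply: le_trans (ler_enormD _ _) _.
  by rewrite mulr_natl mulr2n lerD.
have w0 := enorm_ge0 (v - u).
rewrite !enorm_sqr.
have -> : dot (u - t) (u - t) = dot (v - t) (v - t) + dot (u - v) ((u - t) + (v - t)).
  rewrite (_ : u - v = (u - t) - (v - t)); last by rewrite opprB addrA subrK.
  by move: (u - t) (v - t) => y z; rewrite !dotE (dotC z y); ring.
have -> : dot b (u - t) = dot b (v - t) + dot b (u - v).
  by rewrite -dotDr; congr dot; rewrite [RHS]addrC addrA subrK.
move: (dot b (v - t)) (dot (v - t) _) (dot b (u - v)) (dot (u - v) _) H1 H2 => y z h1 h2 H1 H2.
have H3 : lam * h1 <= lam * (D * enorm (v - u)) by rewrite ler_wpM2l.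
have H4 : lam ^+ 2 * h2 <= lam ^+ 2 * (enorm (v - u) * (2 * D)) by rewrite ler_wpM2l ?sqr_ge0.
have H5 : lam ^+ 2 * (enorm (v - u) * (2 * D)) <= lam * (enorm (v - u) * (2 * D)).
  by rewrite ler_wpM2r ?mulr_ge0// expr2 ler_piMl.
lra.
Qed.

End Replacement.

Section HyperplanesAndDiameters.
Context {R : realType}.

Lemma lebesgue_rV_hyperplane n (s : R) :
  lebesgue_rV R n.+1 ((fun x => x 0 0) @^-1` [set s]) = 0%E.
Proof.
rewrite /= /lebesgue_cons /pushforward.
rewrite (_ : _ @^-1` _ = ([set s] : set (measurableTypeR R)) `*` [set: 'rV[R]_n]); last first.
  by apply/seteqP; split=> [p|p []] /=; rewrite cons_rV0.
rewrite product_measure1E// [X in (X * _)%E](_ : _ = 0%E) ?mul0e//.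
exact: lebesgue_measure_set1.
Qed.

Lemma compact_bounded_coord n (K : set 'rV[R]_n) : compact K ->
  exists M, forall x j, K x -> `|x 0 j| <= M.
Proof.
case: n K => [|n] K cK; first by exists 0 => x [].
have [M [Mr KM]] := compact_bounded cK.
exists (M + 1) => x j Kx; have := KM (M + 1); rewrite ltrDl ltr01 => /(_ isT x Kx).
apply: le_trans; rewrite [leRHS]mx_normrE; apply: le_trans (le_bigmax _ _ (0, j)); exact: lexx.
Qed.

Lemma enorm_le_ediam n (K : set 'rV[R]_n) x y : compact K -> K x -> K y ->
  enorm (x - y) <= ediam K.
Proof.
move=> cK Kx Ky; have [M KM] := compact_bounded_coord cK.
apply: ub_le_sup; last by exists x => //; exists y.
exists (n%:R * (M + M)) => _ [z Kz [w Kw <-]].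
case: n x y K cK Kx Ky KM z w Kz Kw => [|n] x y K cK Kx Ky KM z w Kz Kw.
  by rewrite /enorm big_ord0 sqrtr0 mul0r.
apply: enorm_le_coord => [|j].
  by have := KM z 0 Kz; have := normr_ge0 (z 0 0); lra.
rewrite !mxE; apply: le_trans (ler_normB _ _) _.
by rewrite lerD// KM.
Qed.

End HyperplanesAndDiameters.

(** * Integration over a set of full probability *)

Section FullMeasure.
Context d (X : measurableType d) {R : realType} (mu : probability X R) (S : set X).
Hypotheses (mS : measurable S) (S1 : mu S = 1%E).

Lemma full_setC : mu (~` S) = 0%E.
Proof. by rewrite probability_setC// S1 subee. Qed.

Lemma measurable_fun_extend d' (Y : measurableType d') (f : X -> Y) c :
  measurable_fun S f -> measurable_fun setT (fun x => if x \in S then f x else c).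
Proof.
move=> mf; have SE : (fun x => x \in S) @^-1` [set true] = S by exact: preimage_mem_true.
apply: measurable_fun_if => //.
  by apply: (measurable_fun_bool true); rewrite setTI SE.
by rewrite setTI SE.
Qed.

Lemma full_preimage_extend d' (Y : measurableType d') (f : X -> Y) c A :
  measurable_fun S f -> measurable A ->
  mu ((fun x => if x \in S then f x else c) @^-1` A) = mu (S `&` f @^-1` A).
Proof.
move=> mf mA; apply: (eq_measure_on mS) => //.
- by rewrite -[X in measurable X]setTI; exact: measurable_fun_extend.
- exact: mf.
- exact: full_setC.
- by move=> x Sx; rewrite /= mem_set//; split=> [|[]].
Qed.

Lemma full_integral (f : X -> \bar R) : measurable_fun setT f ->
  (forall x, 0 <= f x)%E -> (\int[mu]_x f x = \int[mu]_(x in S) f x)%E.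
Proof.
move=> mf f0; have mSC : measurable (~` S) by exact: measurableC.
rewrite -(setUv S) ge0_integral_setU ?setUv//; last exact/disj_setPCl.
rewrite (null_set_integral mSC) ?adde0//; last exact: full_setC.
exact: measurable_funTS.
Qed.

Lemma eq_integral_law d' (Y : measurableType d') (f g : X -> Y) (h : Y -> \bar R) :
  measurable_fun S f -> measurable_fun S g -> measurable_fun setT h ->
  (forall y, 0 <= h y)%E ->
  (forall A, measurable A -> mu (S `&` f @^-1` A) = mu (S `&` g @^-1` A)) ->
  (\int[mu]_(x in S) h (f x) = \int[mu]_(x in S) h (g x))%E.
Proof.
move=> mf mg mh h0 fg.
have [S0|/set0P[x0 Sx0]] := eqVneq S set0; first by rewrite S0 !integral_set0.
have H k : measurable_fun S k -> (\int[mu]_(x in S) h (k x) =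
    \int[pushforward mu (fun x => if x \in S then k x else f x0)]_y h y)%E.
  move=> mk; have mk' := measurable_fun_extend (f x0) mk.
  rewrite ge0_integral_pushforward// preimage_setT full_integral//=.
    by apply: eq_integral => x xS; rewrite xS.
  exact: (measurableT_comp mh mk').
rewrite (H _ mf) (H _ mg).
have := measurable_fun_extend (f x0) mf; have := measurable_fun_extend (f x0) mg.
move=> mg' mf'; apply: eq_measure_integral => A mA _ /=.
by rewrite /pushforward !full_preimage_extend//; exact: fg.
Qed.

(** All integrands of the variational argument are in this class, on which the
    real-valued integral is linear without further conditions. *)
Definition bounded_mfun (f : X -> R) :=
  measurable_fun S f /\ exists M, forall x, S x -> `|f x| <= M.

Lemma bounded_integrable f : bounded_mfun f -> mu.-integrable S (EFin \o f).
Proof.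
move=> [mf [M fM]]; apply: measurable_bounded_integrable => //.
  by apply: le_lt_trans (probability_le1 _ mS) _; rewrite ltry.
exists M; split; first exact: num_real.
by move=> N MN x Sx; apply: le_trans (fM _ Sx) _; exact: ltW.
Qed.

Lemma bounded_mfunD f g : bounded_mfun f -> bounded_mfun g ->
  bounded_mfun (fun x => f x + g x).
Proof.
move=> [mf [M fM]] [mg [N gN]]; split; first exact: measurable_funD.
by exists (M + N) => x Sx; apply: le_trans (ler_normD _ _) _; rewrite lerD ?fM ?gN.
Qed.

Lemma bounded_mfunZ r f : bounded_mfun f -> bounded_mfun (fun x => r * f x).
Proof.
move=> [mf [M fM]]; split; first exact: measurable_funM.
by exists (`|r| * M) => x Sx; rewrite normrM ler_wpM2l ?fM.
Qed.

Lemma EFin_Rintegral f : bounded_mfun f ->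
  (\int[mu]_(x in S) f x)%R%:E = (\int[mu]_(x in S) (f x)%:E)%E.
Proof. by move=> bf; rewrite fineK//; apply: integrable_fin_num (bounded_integrable bf). Qed.

Lemma bounded_RintegralD f g : bounded_mfun f -> bounded_mfun g ->
  \int[mu]_(x in S) (f x + g x) = \int[mu]_(x in S) f x + \int[mu]_(x in S) g x.
Proof. by move=> bf bg; rewrite RintegralD//; exact: bounded_integrable. Qed.

Lemma bounded_RintegralZ r f : bounded_mfun f ->
  \int[mu]_(x in S) (r * f x) = r * \int[mu]_(x in S) f x.
Proof. by move=> bf; rewrite RintegralZl//; exact: bounded_integrable. Qed.

Lemma bounded_le_Rintegral f g : bounded_mfun f -> bounded_mfun g ->
  (forall x, S x -> f x <= g x) ->
  \int[mu]_(x in S) f x <= \int[mu]_(x in S) g x.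
Proof. by move=> bf bg; apply: le_Rintegral => //; exact: bounded_integrable. Qed.

End FullMeasure.

(** * Comparison of optimal families *)

Section Perturbation.
Context {R : realType} {n m : nat}.
Local Notation E := 'rV[R]_n.+1.
Variables (lambda : 'I_m.+1 -> R) (S Y : set E) (rho : probability E R) (D : R).
Hypotheses (lambda_gt0 : forall k, 0 < lambda k) (lambda1 : \sum_(k < m.+1) lambda k = 1).
Hypotheses (cS : compact S) (cY : compact Y) (S1 : rho S = 1%E).
Hypothesis (diamD : forall x y, (S `|` Y) x -> (S `|` Y) y -> enorm (x - y) <= D).
Hypothesis rho_ac : rho `<< lebesgue_rV R n.+1.
Variables (p0 : E) (Sp0 : S p0).

Lemma compact_measurable_rV (K : set E) : compact K -> measurable K.
Proof.
move=> cK; rewrite -(setCK K); apply: measurableC; apply: open_measurable_rV.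
by apply: closed_openC; apply: compact_closed cK; exact: norm_hausdorff.
Qed.

Let mS : measurable S. Proof. exact: compact_measurable_rV. Qed.
Let mY : measurable Y. Proof. exact: compact_measurable_rV. Qed.

Let D_ge0 : 0 <= D.
Proof. exact: le_trans (enorm_ge0 _) (diamD (or_introl Sp0) (or_introl Sp0)). Qed.

Lemma barycenter_mapE (T : 'I_m -> E -> E) x :
  barycenter_map lambda T x = \sum_(k < m.+1) lambda k *: fcons x (fun j => T j x) k.
Proof.
rewrite /barycenter_map big_ord_recl /fcons unlift_none; congr (_ + _).
by apply: eq_bigr => j _; rewrite liftK.
Qed.

Lemma fcons_replace (T : 'I_m -> E -> E) (V : E -> E) i x :
  fcons x (fun j => (if j == i then V else T j) x) =
  fun k => if k == lift ord0 i then V x else fcons x (fun j => T j x) k.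
Proof.
apply/funext => k; rewrite /fcons; case: (unliftP ord0 k) => [j|] -> /=.
  by rewrite (inj_eq lift_inj); case: ifP.
by [].
Qed.

Lemma fcons_lift (T : 'I_m -> E -> E) x i : fcons x (fun j => T j x) (lift ord0 i) = T i x.
Proof. by rewrite /fcons liftK. Qed.

(** The barycenter is a convex combination of points of [S] and [Y]. *)
Lemma enorm_barycenter_le (T : 'I_m -> E -> E) x :
  S x -> (forall j, Y (T j x)) -> enorm (barycenter_map lambda T x - p0) <= D.
Proof.
move=> Sx YT; rewrite barycenter_mapE -sum_lambda_shift//.
apply: le_trans (ler_enorm_sum _ _ _) _.
rewrite -[leRHS]mul1r -lambda1 mulr_suml; apply: ler_sum => k _.
rewrite enormZ gtr0_norm// ler_wpM2l ?(ltW (lambda_gt0 _))//.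
apply: diamD; last by left.
rewrite /fcons; case: (unliftP ord0 k) => [j|] _ /=; first by right.
by left.
Qed.

Let bounded_sqr (f : E -> E) : measurable_fun S f ->
  (forall x, S x -> enorm (f x) <= D) -> bounded_mfun S (fun x => enorm (f x) ^+ 2).
Proof.
move=> mf fD; split; first by apply: measurable_funX; exact: measurable_fun_enorm.
exists (D ^+ 2) => x Sx; by rewrite ger0_norm ?sqr_ge0// lerXn2r ?nnegrE ?enorm_ge0 ?fD.
Qed.

Let bounded_enorm (f : E -> E) : measurable_fun S f ->
  (forall x, S x -> enorm (f x) <= D) -> bounded_mfun S (fun x => enorm (f x)).
Proof.
move=> mf fD; split; first exact: measurable_fun_enorm.
by exists D => x Sx; rewrite ger0_norm ?enorm_ge0 ?fD.
Qed.

Let measurable_dot (f g : E -> E) : measurable_fun S f -> measurable_fun S g ->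
  measurable_fun S (fun x => dot (f x) (g x)).
Proof.
move=> mf mg; apply: measurable_sum => j.
by apply: measurable_funM; exact: measurable_fun_coord.
Qed.

Let bounded_dot (f g : E -> E) : measurable_fun S f -> measurable_fun S g ->
  (forall x, S x -> enorm (f x) <= D) -> (forall x, S x -> enorm (g x) <= D) ->
  bounded_mfun S (fun x => dot (f x) (g x)).
Proof.
move=> mf mg fD gD; split; first exact: measurable_dot.
exists (D * D) => x Sx; rewrite ler_norml; apply/andP; split.
  rewrite lerNl -dotNl; apply: le_trans (dot_le_enorm _ _) _.
  by rewrite enormN ler_pM ?enorm_ge0 ?fD ?gD.
apply: le_trans (dot_le_enorm _ _) _.
by rewrite ler_pM ?enorm_ge0 ?fD ?gD.
Qed.

Lemma measurable_barycenter (T : 'I_m -> E -> E) : (forall j, measurable_fun S (T j)) ->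
  measurable_fun S (barycenter_map lambda T).
Proof.
move=> mT; apply: measurable_funD_rV; first exact: measurable_funZ_rV.
by apply: measurable_fun_sum_rV => j; exact: measurable_funZ_rV.
Qed.

Let bounded_cost (T : 'I_m -> E -> E) : (forall j, measurable_fun S (T j)) ->
  (forall j x, S x -> Y (T j x)) ->
  bounded_mfun S (fun x => barycentric_cost lambda (fcons x (fun j => T j x))).
Proof.
move=> mT YT.
have -> : (fun x => barycentric_cost lambda (fcons x (fun j => T j x))) =
    (fun x => (2^-1 * \sum_(k < m.+1) lambda k * enorm (fcons x (fun j => T j x) k - p0) ^+ 2)
      + (- 2^-1) * enorm (barycenter_map lambda T x - p0) ^+ 2).
  by apply/funext => x; rewrite (barycentric_costE lambda1 _ p0) barycenter_mapE mulNr.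
have bsum (s : seq 'I_m.+1) : bounded_mfun S
    (fun x => \sum_(k <- s) lambda k * enorm (fcons x (fun j => T j x) k - p0) ^+ 2).
  elim: s => [|k s IH].
    split; first by under eq_fun do rewrite big_nil; exact: measurable_cst.
    by exists 0 => x _; rewrite big_nil normr0.
  under eq_fun do rewrite big_cons.
  apply: bounded_mfunD => //; apply: bounded_mfunZ => //.
  apply: bounded_sqr.
    apply: measurable_funB_rV => //; rewrite /fcons.
    by case: (unlift ord0 k) => [j|] //=.
  move=> x Sx; apply: diamD; last by left.
  by rewrite /fcons; case: (unlift ord0 k) => [j|] /=; [right; exact: YT|left].
apply: bounded_mfunD => //; apply: bounded_mfunZ => //.
apply: bounded_sqr => [|x Sx]; last by apply: enorm_barycenter_le => // j; exact: YT.
by apply: measurable_funB_rV => //; exact: measurable_barycenter.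
Qed.

(** Optimality of [T] is tested against the competitor that replaces [T_i] by
    a map [V] with the same law; the cost is quadratic along this
    replacement, and the terms that depend on [T_i] and [V] alone cancel
    because the laws agree. *)
Lemma mmot_replace_le (mu : 'I_m -> probability E R) (T : 'I_m -> E -> E) i (V : E -> E) :
  mmot_maps lambda S Y rho mu T -> transport_map S Y rho (mu i) V ->
  \int[rho]_(x in S) (2 * lambda (lift ord0 i) *
      dot (barycenter_map lambda T x - p0) (V x - T i x)
    + lambda (lift ord0 i) ^+ 2 * enorm (V x - T i x) ^+ 2) <= 0.
Proof.
move=> [tT optT] tV.
have mT j : measurable_fun S (T j) by have [] := tT j.
have YT j x : S x -> Y (T j x) by have [_ + _] := tT j; exact.
have [mV YV lawV] := tV; have [_ _ lawT] := tT i.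
pose T' j := if j == i then V else T j.
have tT' j : transport_map S Y rho (mu j) (T' j).
  by rewrite /T'; case: eqP => [->|_].
have mT' j : measurable_fun S (T' j) by have [] := tT' j.
have YT' j x : S x -> Y (T' j x) by have [_ + _] := tT' j; exact.
pose c (T : 'I_m -> E -> E) x := barycentric_cost lambda (fcons x (fun j => T j x)).
have bc : bounded_mfun S (c T) := bounded_cost mT YT.
have bc' : bounded_mfun S (c T') := bounded_cost mT' YT'.
have ccle : \int[rho]_(x in S) c T x <= \int[rho]_(x in S) c T' x.
  have := optT T' tT'; rewrite /mmot_cost.
  rewrite -(EFin_Rintegral rho mS bc) -(EFin_Rintegral rho mS bc').
  by rewrite lee_fin.
have bf f : measurable_fun S f -> (forall x, S x -> Y (f x)) ->
    bounded_mfun S (fun x => enorm (f x - p0) ^+ 2).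
  move=> mf Yf; apply: bounded_sqr => [|x Sx]; first exact: measurable_funB_rV.
  by apply: diamD; [right; exact: Yf|left].
have bV := bf _ mV YV; have bT := bf _ (mT i) (YT i).
have lawVT : \int[rho]_(x in S) enorm (V x - p0) ^+ 2 =
    \int[rho]_(x in S) enorm (T i x - p0) ^+ 2.
  congr fine.
  apply: (@eq_integral_law _ _ _ rho S mS S1 _ _ V (T i)
    (fun y => (enorm (y - p0) ^+ 2)%:E)) => //.
  - apply/measurable_EFinP; apply: measurable_funX; apply: measurable_fun_enorm.
    exact: measurable_funB_rV.
  - by move=> y; rewrite lee_fin sqr_ge0.
  - by move=> A mA; rewrite lawV// lawT.
set lam := lambda (lift ord0 i).
have -> : (fun x => 2 * lam * dot (barycenter_map lambda T x - p0) (V x - T i x)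
    + lam ^+ 2 * enorm (V x - T i x) ^+ 2) =
  (fun x => (2 * c T x + (-2) * c T' x) +
    (lam * enorm (V x - p0) ^+ 2 + (- lam) * enorm (T i x - p0) ^+ 2)).
  apply/funext => x.
  have H : 2 * c T' x = 2 * c T x
      + lam * (enorm (V x - p0) ^+ 2 - enorm (T i x - p0) ^+ 2)
      - (2 * lam * dot (barycenter_map lambda T x - p0) (V x - T i x)
        + lam ^+ 2 * enorm (V x - T i x) ^+ 2).
    rewrite /c /T' fcons_replace (barycentric_cost_replace _ _ _ p0 lambda1).
    by rewrite -barycenter_mapE fcons_lift.
  move: (c T x) (c T' x) (dot _ _) (enorm (V x - T i x)) H => a a' y z H.
  rewrite (mulNr 2) H; ring.
have b1 := bounded_mfunZ 2 bc; have b2 := bounded_mfunZ (-2) bc'.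
have b3 := bounded_mfunZ lam bV; have b4 := bounded_mfunZ (- lam) bT.
rewrite (bounded_RintegralD rho mS (bounded_mfunD b1 b2) (bounded_mfunD b3 b4)).
rewrite (bounded_RintegralD rho mS b1 b2) (bounded_RintegralD rho mS b3 b4).
rewrite (bounded_RintegralZ rho mS 2 bc) (bounded_RintegralZ rho mS (-2) bc').
rewrite (bounded_RintegralZ rho mS lam bV) (bounded_RintegralZ rho mS (- lam) bT).
move: (\int[rho]_(x in S) c T x) (\int[rho]_(x in S) c T' x) ccle => a a' aa'.
move: (\int[rho]_(x in S) enorm (V x - p0) ^+ 2) lawVT => v ->.
move: (\int[rho]_(x in S) enorm (T i x - p0) ^+ 2) => t; lra.
Qed.

Lemma rho_hyperplane s : rho ((fun x : E => x 0 0) @^-1` [set s]) = 0%E.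
Proof.
apply: (null_content_dominatesP _ _).1 rho_ac _ _ (lebesgue_rV_hyperplane _ _).
by rewrite -[X in measurable X]setTI; exact: measurable_coord.
Qed.

(** The map [U] has the wrong law to compete with [T i], but by
    [exists_transport_near] genuine competitors come as close to it in the
    mean as the cost [w] of the coupling allows. The Lipschitz bound transfers
    [mmot_replace_le] from these competitors to [U]. *)
Lemma mmot_coupling_le (mu : 'I_m -> probability E R) (T : 'I_m -> E -> E) i (U : E -> E)
    d (Om : measurableType d) (gamma : probability Om R) (p q : Om -> E) (w : R) :
  mmot_maps lambda S Y rho mu T -> measurable_fun S U -> (forall x, S x -> Y (U x)) ->
  measurable_fun setT p -> measurable_fun setT q ->
  (forall A, measurable A -> gamma (p @^-1` A) = mu i A) ->
  (forall A, measurable A -> rho (S `&` U @^-1` A) = gamma (q @^-1` A)) ->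
  (\int[gamma]_z (enorm (p z - q z))%:E = w%:E)%E ->
  2 * lambda (lift ord0 i) *
    (\int[rho]_(x in S) dot (barycenter_map lambda T x - p0) (U x - T i x))
  + lambda (lift ord0 i) ^+ 2 * (\int[rho]_(x in S) enorm (U x - T i x) ^+ 2)
  <= 4 * D * lambda (lift ord0 i) * w.
Proof.
move=> optT mU YU mp mq pE qE wE; set lam := lambda (lift ord0 i).
have [tT _] := optT.
have mT j : measurable_fun S (T j) by have [] := tT j.
have YT j x : S x -> Y (T j x) by have [_ + _] := tT j; exact.
have lam01 : 0 <= lam <= 1.
  apply/andP; split; first exact: ltW (lambda_gt0 _).
  rewrite -[leRHS]lambda1 (bigD1 (lift ord0 i))//= lerDl.
  by apply: sumr_ge0 => k _; exact: ltW (lambda_gt0 _).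
have /andP[lam0 lam1] := lam01.
have DY x y : Y x -> Y y -> enorm (x - y) <= D by move=> Yx Yy; apply: diamD; right.
have bB x : S x -> enorm (barycenter_map lambda T x - p0) <= D.
  by move=> Sx; apply: enorm_barycenter_le => // j; exact: YT.
have mB : measurable_fun S (fun x => barycenter_map lambda T x - p0).
  by apply: measurable_funB_rV => //; exact: measurable_barycenter.
have bd f : measurable_fun S f -> (forall x, S x -> Y (f x)) ->
    bounded_mfun S (fun x => dot (barycenter_map lambda T x - p0) (f x - T i x)) /\
    bounded_mfun S (fun x => enorm (f x - T i x) ^+ 2).
  move=> mf Yf; split.
    apply: bounded_dot => //; first exact: measurable_funB_rV.
    by move=> x Sx; apply: DY; [exact: Yf|exact: YT].
  apply: bounded_sqr; first exact: measurable_funB_rV.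
  by move=> x Sx; apply: DY; [exact: Yf|exact: YT].
have [bU1 bU2] := bd _ mU YU.
rewrite -(bounded_RintegralZ rho mS _ bU1) -(bounded_RintegralZ rho mS _ bU2).
rewrite -(bounded_RintegralD rho mS (bounded_mfunZ _ bU1) (bounded_mfunZ _ bU2)).
apply/ler_addgt0Pr => e e0.
(* The summand 1 keeps the denominator positive when [D] is 0. *)
pose eps := e / (4 * D * lam + 1).
have den0 : 0 < 4 * D * lam + 1 by rewrite ltr_wpDl// !mulr_ge0.
have eps0 : 0 < eps by rewrite divr_gt0.
have [M KM] := compact_bounded_coord cY.
have YTp0 : Y (T i p0) by exact: YT.
have pY0 : gamma (p @^-1` (~` Y)) = 0%E.
  have [_ _ lawT] := tT i; rewrite pE -?lawT; [|exact: measurableC|exact: measurableC].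
  rewrite (_ : _ `&` _ = set0) ?measure0// -subset0 => x [Sx /=]; apply.
  exact: YT.
pose U' x := if x \in S then U x else p0.
have mU' : measurable_fun setT U' by exact: measurable_fun_extend.
have U'E A : measurable A -> rho (U' @^-1` A) = gamma (q @^-1` A).
  by move=> mA; rewrite -qE//; exact: full_preimage_extend.
have [V [mV YV VE VU]] := exists_transport_near (measurable_coord 0) rho_hyperplane
  mp mq mU' mY (ex_intro _ _ YTp0) KM pY0 U'E eps0.
have mVS : measurable_fun S V by exact: measurable_funTS.
have YVS x : S x -> Y (V x) by move=> _; exact: YV.
have tV : transport_map S Y rho (mu i) V.
  split => // A mA; rewrite -pE// -VE//; apply: (eq_measure_on mS) => //.
  - exact: mVS.
  - by rewrite -[X in measurable X]setTI; exact: mV.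
  - exact: full_setC.
  - by move=> x Sx; split=> [[]|].
have [bV1 bV2] := bd _ mVS YVS.
have bVU : bounded_mfun S (fun x => enorm (V x - U x)).
  apply: bounded_enorm; first exact: measurable_funB_rV.
  by move=> x Sx; apply: DY => //; exact: YU.
have JVU : \int[rho]_(x in S) enorm (V x - U x) <= w + eps.
  rewrite -lee_fin (EFin_Rintegral rho mS bVU) EFinD -wE; apply: le_trans VU.
  rewrite (full_integral mS S1); last 2 first.
  - apply/measurable_EFinP; apply: measurable_fun_enorm; exact: measurable_funB_rV.
  - by move=> x; rewrite lee_fin enorm_ge0.
  have -> // : (\int[rho]_(x in S) (enorm (V x - U x))%:E =
    \int[rho]_(x in S) (enorm (V x - U' x))%:E)%E.
  by apply: eq_integral => x xS; rewrite /U' xS.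
have bV12 := bounded_mfunD (bounded_mfunZ (2 * lam) bV1) (bounded_mfunZ (lam ^+ 2) bV2).
have bVU' := bounded_mfunZ (4 * D * lam) bVU.
apply: (@le_trans _ _ (\int[rho]_(x in S)
  ((2 * lam * dot (barycenter_map lambda T x - p0) (V x - T i x)
    + lam ^+ 2 * enorm (V x - T i x) ^+ 2) + 4 * D * lam * enorm (V x - U x)))).
  apply: bounded_le_Rintegral => //.
  - exact: bounded_mfunD (bounded_mfunZ _ bU1) (bounded_mfunZ _ bU2).
  - exact: bounded_mfunD bV12 bVU'.
  - move=> x Sx; apply: replacement_lipschitz => //; first exact: bB.
      by apply: DY; [exact: YU|exact: YT].
    by apply: DY; [exact: YV|exact: YT].
rewrite (bounded_RintegralD rho mS bV12 bVU') (bounded_RintegralZ rho mS _ bVU).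
have := mmot_replace_le optT tV; rewrite -/lam.
move: (Rintegral _ _ _) (Rintegral _ _ _) JVU => a b bw a0.
have : 4 * D * lam * b <= 4 * D * lam * (w + eps).
  by apply: ler_wpM2l bw; rewrite !mulr_ge0.
have : 4 * D * lam * eps <= e.
  by rewrite /eps mulrA ler_pdivrMr// mulrC ler_wpM2l ?lerDl// ltW.
lra.
Qed.

(** Compare [T' i] with [T i] and [T i] with [T' i]: as both families have the
    same barycenter, the linear terms cancel in the sum and the quadratic ones
    add up. *)
Lemma mmot_maps_dist_le (mu mu' : 'I_m -> probability E R) (T T' : 'I_m -> E -> E) i
    (gamma : probability (E * E)%type R) (w : R) :
  mmot_maps lambda S Y rho mu T -> mmot_maps lambda S Y rho mu' T' ->
  ae_eq rho S (barycenter_map lambda T) (barycenter_map lambda T') ->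
  coupling (mu i) (mu' i) gamma -> (\int[gamma]_z (enorm (z.1 - z.2))%:E = w%:E)%E ->
  lambda (lift ord0 i) ^+ 2 * (\int[rho]_(x in S) enorm (T i x - T' i x) ^+ 2)
  <= 4 * D * lambda (lift ord0 i) * w.
Proof.
move=> optT optT' BB' [gmu gmu'] wE; set lam := lambda (lift ord0 i).
have [tT _] := optT; have [tT' _] := optT'.
have mT j : measurable_fun S (T j) by have [] := tT j.
have mT' j : measurable_fun S (T' j) by have [] := tT' j.
have YT j x : S x -> Y (T j x) by have [_ + _] := tT j; exact.
have YT' j x : S x -> Y (T' j x) by have [_ + _] := tT' j; exact.
have [_ _ lawT] := tT i; have [_ _ lawT'] := tT' i.
have wE' : (\int[gamma]_z (enorm (z.2 - z.1))%:E = w%:E)%E.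
  by rewrite -wE; apply: eq_integral => z _; rewrite enormB.
have H := mmot_coupling_le optT (mT' i) (YT' i) measurable_fst measurable_snd gmu
  (fun A mA => etrans (lawT' A mA) (esym (gmu' A mA))) wE.
have H' := mmot_coupling_le optT' (mT i) (YT i) measurable_snd measurable_fst gmu'
  (fun A mA => etrans (lawT A mA) (esym (gmu A mA))) wE'.
rewrite -/lam in H H' *.
have E1 : \int[rho]_(x in S) enorm (T' i x - T i x) ^+ 2 =
    \int[rho]_(x in S) enorm (T i x - T' i x) ^+ 2.
  by apply: eq_Rintegral => x _; rewrite enormB.
have bB x : S x -> enorm (barycenter_map lambda T x - p0) <= D.
  by move=> Sx; apply: enorm_barycenter_le => // j; exact: YT.
have mB : measurable_fun S (fun x => barycenter_map lambda T x - p0).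
  by apply: measurable_funB_rV => //; exact: measurable_barycenter.
have mB' : measurable_fun S (fun x => barycenter_map lambda T' x - p0).
  by apply: measurable_funB_rV => //; exact: measurable_barycenter.
have mTT' : measurable_fun S (fun x => T i x - T' i x) by exact: measurable_funB_rV.
have bTT' : bounded_mfun S (fun x => dot (barycenter_map lambda T x - p0) (T' i x - T i x)).
  apply: bounded_dot => //; first exact: measurable_funB_rV.
  by move=> x Sx; apply: diamD; right; [exact: YT'|exact: YT].
have E2 : \int[rho]_(x in S) dot (barycenter_map lambda T' x - p0) (T i x - T' i x) =
    - \int[rho]_(x in S) dot (barycenter_map lambda T x - p0) (T' i x - T i x).
  rewrite -mulN1r -(bounded_RintegralZ rho mS _ bTT').
  congr fine; apply: ae_eq_integral => //.
  - by apply/measurable_EFinP; exact: measurable_dot.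
  - apply/measurable_EFinP; apply: measurable_funM => //; apply: measurable_dot => //.
    exact: measurable_funB_rV.
  - apply: filterS BB' => x /[apply] ->.
    by rewrite mulN1r -dotNr opprB.
move: H H'; rewrite E1 E2.
move: (Rintegral _ _ _) (Rintegral _ _ _) => a b; lra.
Qed.

Lemma mmot_maps_W1_le (mu mu' : 'I_m -> probability E R) (T T' : 'I_m -> E -> E) i (w : R) :
  mmot_maps lambda S Y rho mu T -> mmot_maps lambda S Y rho mu' T' ->
  ae_eq rho S (barycenter_map lambda T) (barycenter_map lambda T') ->
  W1 (mu i) (mu' i) = w%:E ->
  lambda (lift ord0 i) ^+ 2 * (\int[rho]_(x in S) enorm (T i x - T' i x) ^+ 2)
  <= 4 * D * (lambda (lift ord0 i) * w).
Proof.
move=> optT optT' BB' wE; set lam := lambda (lift ord0 i).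
have lam0 : 0 <= lam by exact: ltW (lambda_gt0 _).
have den0 : 0 < 4 * D * lam + 1 by rewrite ltr_wpDl// !mulr_ge0.
apply/ler_addgt0Pr => e e0.
have eps0 : 0 < e / (4 * D * lam + 1) by rewrite divr_gt0.
have fW : W1 (mu i) (mu' i) \is a fin_num by rewrite wE.
have [_ [gamma gc <-] gw] := lb_ereal_inf_adherent eps0 fW.
rewrite -/(W1 _ _) wE -EFinD in gw.
have [v vE] : exists v, (\int[gamma]_z (enorm (z.1 - z.2))%:E = v%:E)%E.
  exists (fine (\int[gamma]_z (enorm (z.1 - z.2))%:E)%E); rewrite fineK//.
  rewrite ge0_fin_numE; last by apply: integral_ge0 => z _; rewrite lee_fin enorm_ge0.
  exact: lt_trans gw (ltry _).
apply: le_trans (mmot_maps_dist_le optT optT' BB' gc vE) _; rewrite -/lam.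
move: gw; rewrite vE lte_fin => vw.
have : 4 * D * lam * v <= 4 * D * lam * (w + e / (4 * D * lam + 1)).
  by apply: ler_wpM2l (ltW vw); rewrite !mulr_ge0.
have : 4 * D * lam * (e / (4 * D * lam + 1)) <= e.
  by rewrite mulrA ler_pdivrMr// mulrC ler_wpM2l ?lerDl// ltW.
lra.
Qed.

Lemma L2_distE (T T' : E -> E) : measurable_fun S T -> measurable_fun S T' ->
  (forall x, S x -> Y (T x)) -> (forall x, S x -> Y (T' x)) ->
  L2_dist S rho T T' = (Num.sqrt (\int[rho]_(x in S) enorm (T x - T' x) ^+ 2))%:E.
Proof.
move=> mT mT' YT YT'; rewrite /L2_dist unlock.
have bTT' : bounded_mfun S (fun x => enorm (T x - T' x) ^+ 2).
  apply: bounded_sqr => [|x Sx]; first exact: measurable_funB_rV.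
  by apply: diamD; right; [exact: YT|exact: YT'].
rewrite -powR12_sqrt; last by apply: Rintegral_ge0 => x _; exact: sqr_ge0.
rewrite -poweR_EFin (EFin_Rintegral rho mS bTT'); congr (_ `^ _)%E.
rewrite [RHS]integral_mkcond; apply: eq_integral => x _.
rewrite /patch; case: ifP => _.
  by rewrite /= ger0_norm ?enorm_ge0// powR_mulrn ?enorm_ge0.
by rewrite /= normr0 powR0// pnatr_eq0.
Qed.

(** The weight appears squared on the left of [mmot_maps_W1_le] and only once
    on the right, so that taking roots puts it exactly where it is needed; the
    roots of the summands are bounded by the root of the sum, whence the
    factor [m]. *)
Lemma mmot_maps_stability (mu mu' : 'I_m -> probability E R) (T T' : 'I_m -> E -> E) :
  mmot_maps lambda S Y rho mu T -> mmot_maps lambda S Y rho mu' T' ->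
  ae_eq rho S (barycenter_map lambda T) (barycenter_map lambda T') ->
  (\sum_(i < m) (lambda (lift ord0 i))%:E * L2_dist S rho (T i) (T' i) <=
   (2 * m%:R * Num.sqrt D + 1)%:E *
     (\sum_(i < m) (lambda (lift ord0 i))%:E * W1 (mu i) (mu' i)) `^ 2^-1)%E.
Proof.
move=> optT optT' BB'.
have [tT _] := optT; have [tT' _] := optT'.
have mT j : measurable_fun S (T j) by have [] := tT j.
have mT' j : measurable_fun S (T' j) by have [] := tT' j.
have YT j x : S x -> Y (T j x) by have [_ + _] := tT j; exact.
have YT' j x : S x -> Y (T' j x) by have [_ + _] := tT' j; exact.
have W0 i : (0 <= W1 (mu i) (mu' i))%E.
  apply/ereal_infP => _ [gamma _ <-]; apply: integral_ge0 => z _.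
  by rewrite lee_fin enorm_ge0.
have lW0 i : (0 <= (lambda (lift ord0 i))%:E * W1 (mu i) (mu' i))%E.
  by rewrite mule_ge0// lee_fin; exact: ltW (lambda_gt0 _).
have C0 : 0 < 2 * m%:R * Num.sqrt D + 1 by rewrite ltr_wpDl// !mulr_ge0 ?sqrtr_ge0.
have sum0 : (0 <= \sum_(i < m) (lambda (lift ord0 i))%:E * W1 (mu i) (mu' i))%E.
  by apply: sume_ge0 => i _; exact: lW0.
case tE : (\sum_(i < m) _)%E sum0 => [t||] //; last first.
  by rewrite poweRyr ?invr_neq0// gt0_muley ?leey.
rewrite lee_fin => t0.
have term i : ((lambda (lift ord0 i))%:E * L2_dist S rho (T i) (T' i) <=
    (2 * Num.sqrt D * Num.sqrt t)%:E)%E.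
  have lW : ((lambda (lift ord0 i))%:E * W1 (mu i) (mu' i) <= t%:E)%E.
    by rewrite -tE (bigD1 i)//= leeDl//; apply: sume_ge0 => j _; exact: lW0.
  have [w wE] : exists w, W1 (mu i) (mu' i) = w%:E.
    move: lW (W0 i); case: (W1 _ _) => [w||]//; first by exists w.
    by rewrite gt0_muley ?lte_fin ?lambda_gt0// leye_eq.
  move: lW; rewrite wE -EFinM lee_fin => lW.
  rewrite (L2_distE (mT i) (mT' i) (YT i) (YT' i)) -EFinM lee_fin.
  have := mmot_maps_W1_le optT optT' BB' wE.
  set lam := lambda _ in lW *; have lam0 : 0 <= lam by exact: ltW (lambda_gt0 _).
  move=> H.
  rewrite -[X in X * _](ger0_norm lam0) -sqrtr_sqr -sqrtrM ?sqr_ge0//.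
  rewrite (_ : 2 * Num.sqrt D * Num.sqrt t = Num.sqrt (4 * D * t)).
    by apply: ler_wsqrtr; apply: le_trans H _; rewrite ler_wpM2l ?mulr_ge0.
  rewrite sqrtrM ?mulr_ge0// sqrtrM//; congr (_ * _ * _).
  by rewrite (_ : 4 = 2 ^+ 2) ?sqrtr_sqr ?ger0_norm// expr2 -natrM.
apply: (@le_trans _ _ (\sum_(i < m) (2 * Num.sqrt D * Num.sqrt t)%:E)%E).
  by apply: lee_sum => i _; exact: term.
rewrite sumEFin sumr_const card_ord poweR_EFin powR12_sqrt// -EFinM lee_fin.
rewrite -mulr_natl; have := sqrtr_ge0 t; lra.
Qed.

End Perturbation.

(** * Stability *)

Theorem corollary1p5 (R : realType) (m : nat) (hN : (3 <= m.+1)%N) (D : R) :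
  exists C : R, 0 < C /\
  forall (n : nat) (lambda : 'I_m.+1 -> R) (S Y : set 'rV[R]_n)
    (rho : probability 'rV[R]_n R) (mu mu' : 'I_m -> probability 'rV[R]_n R)
    (T T' : 'I_m -> 'rV[R]_n -> 'rV[R]_n),
  (forall i, 0 < lambda i) ->
  \sum_(i < m.+1) lambda i = 1 ->
  compact S -> compact Y ->
  ediam (S `|` Y) = D ->
  rho S = 1%E -> rho `<< lebesgue_rV R n ->
  (forall i, mu i Y = 1%E) -> (forall i, mu' i Y = 1%E) ->
  mmot_maps lambda S Y rho mu T ->
  mmot_maps lambda S Y rho mu' T' ->
  ae_eq rho S (barycenter_map lambda T) (barycenter_map lambda T') ->
  (\sum_(i < m) (lambda (lift ord0 i))%:E * L2_dist S rho (T i) (T' i) <=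
   C%:E * (\sum_(i < m) (lambda (lift ord0 i))%:E * W1 (mu i) (mu' i)) `^ 2^-1)%E.
Proof.
exists (2 * m%:R * Num.sqrt D + 1); split.
  by rewrite ltr_wpDl// !mulr_ge0 ?sqrtr_ge0.
(* In dimension 0 every measure is concentrated at one point, so that atomless
   measures do not exist; but all maps coincide. *)
case=> [|n] lambda S Y rho mu mu' T T' lambda_gt0 lambda1 cS cY diamD S1 rho_ac muY mu'Y
  optT optT' BB'.
  have L0 i : L2_dist S rho (T i) (T' i) = 0%E.
    rewrite /L2_dist (_ : _ \_ S = cst 0%E) ?Lnorm0//; apply/funext => x.
    by rewrite /patch; case: ifP => // _; rewrite /enorm big_ord0 sqrtr0.
  rewrite big1 => [|i _]; last by rewrite L0 mule0.
  by rewrite mule_ge0 ?poweR_ge0// lee_fin addr_ge0// !mulr_ge0 ?sqrtr_ge0.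
have /set0P[p0 Sp0] : S != set0.
  by apply/eqP => S0; have := S1; rewrite S0 measure0 => /eqP; rewrite eqe eq_sym oner_eq0.
apply: (mmot_maps_stability lambda_gt0 lambda1 cS cY S1 _ rho_ac Sp0) => // x y Kx Ky.
rewrite -diamD; apply: enorm_le_ediam => //.
exact: compactU.
Qed.
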